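(* Let $r\ge2$, let $n$ be sufficiently large, and let $1\le q\le\frac{n}{20^3r}$. Suppose $G$ has the maximum spectral radius among all graphs obtained from some complete $r$-partite graph $K_r(n_1,\dots,n_r)$, where $n_1\ge\cdots\ge n_r$ are any integers with $\sum_{i=1}^r n_i=n$, by adding $q$ class-edges. Then $G$ is isomorphic to $L_{n,r,q}$.
   Context: $K_r(n_1,\dots,n_r)$ is the complete $r$-partite graph with part sizes $n_1,\dots,n_r$; a class-edge is an edge with both ends in the same part. $T_{n,r}$ is the $n$-vertex complete $r$-partite graph with part sizes as equal as possible. $L_{n,r,q}$ is the graph obtained by embedding a graph $H$ with $q$ edges into a smallest part of $T_{n,r}$, where $H=K_3$ if $q=3$ and $H$ is a star with $q$ edges otherwise. Spectral radius means the largest eigenvalue of the adjacency matrix. *)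

(* Defs.v *)
From HB Require Import structures.
From mathcomp Require Import all_boot all_order all_algebra.
From mathcomp Require Import boolp classical_sets reals.
From mathcomp Require Import complex polyrcf.
Set Implicit Arguments.
Unset Strict Implicit.
Unset Printing Implicit Defensive.
Import Order.TTheory GRing.Theory Num.Theory.

Local Open Scope ring_scope.

Record sgraph := SGraph {
  vertex :> finType;
  adj : rel vertex;
  adj_sym : symmetric adj;
  adj_irr : irreflexive adj }.

Definition graph_iso (G H : sgraph) : Prop :=
  exists2 f : G -> H, bijective f & {mono f : x y / adj x y}.

Definition adjmx (R : realType) (G : sgraph) : 'M[R]_#|G| :=
  \matrix_(i, j) (adj (enum_val i) (enum_val j))%:R.

(* For a graph with at least one vertex this supremum is attained; see
   [spectral_radius_max]. *)
Definition spectral_radius (R : realType) (G : sgraph) : R :=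
  sup [set x : R | eigenvalue (adjmx R G) x]%classic.

Lemma eigenvalue_adjmx_ex (R : realType) (G : sgraph) :
  (0 < #|G|)%N -> exists x, eigenvalue (adjmx R G) x.
Proof.
move=> G_gt0; pose f := real_complex R; pose B := map_mx f (adjmx R G).
have [|z] := closed_rootP (char_poly B) _.
  by rewrite size_char_poly eqSS -lt0n.
rewrite -eigenvalue_root_char => eigz; have /eigenvalueP[v vB v0] := eigz.
have BT : (map_mx Num.conj B)^T = B.
  apply/matrixP=> i j; rewrite !mxE adj_sym /f /=.
  by rewrite rmorph_nat conjC_nat.
pose w := (map_mx Num.conj v)^T.
have wB : B *m w = z^* *: w.
  rewrite -[B in LHS]BT -trmx_mul -map_mxM vB; apply/matrixP=> i j.
  by rewrite !mxE rmorphM.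
have vw0 : v *m w != 0.
  apply: contra v0 => /eqP/matrixP/(_ 0 0); rewrite !mxE => /eqP.
  under eq_bigr do rewrite !mxE.
  rewrite psumr_eq0 => [/allP vi0|i _]; last exact: mul_conjC_ge0.
  apply/eqP/rowP=> i; rewrite mxE; apply/eqP.
  by have := vi0 i (mem_index_enum _); rewrite mul_conjC_eq0.
have zR : z^* = z.
  have: z *: (v *m w) = z^* *: (v *m w).
    by rewrite scalemxAl -vB -mulmxA wB -scalemxAr.
  move/eqP; rewrite -subr_eq0 -scalerBl scaler_eq0 (negPf vw0) orbF subr_eq0.
  by move/eqP.
have /complex_realP[x zx] : z \is Num.real by apply/CrealP.
by exists x; move: eigz; rewrite zx eigenvalue_map.
Qed.

Lemma spectral_radius_max (R : realType) (G : sgraph) : (0 < #|G|)%N ->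
  eigenvalue (adjmx R G) (spectral_radius R G) /\
  forall x, eigenvalue (adjmx R G) x -> x <= spectral_radius R G.
Proof.
move=> G_gt0; set A := adjmx R G; have [x0 eigx0] := eigenvalue_adjmx_ex R G_gt0.
have p0 : char_poly A != 0 by rewrite monic_neq0 ?char_poly_monic.
pose s := rootsR (char_poly A).
have sP x : (x \in s) = eigenvalue A x.
  by rewrite eigenvalue_root_char -roots_on_rootsR.
pose m := \big[Num.max/x0]_(x <- s) x.
have ms : eigenvalue A m.
  rewrite /m big_seq; elim/big_ind: _ => // [x y Hx Hy|x].
    by case: (leP x y).
  by rewrite sP.
have ubm x : eigenvalue A x -> x <= m by rewrite -sP => xs; exact: le_bigmax_seq.
suff -> : spectral_radius R G = m by [].
apply/eqP; rewrite eq_le; apply/andP; split.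
  by apply: ge_sup; [exists x0 | move=> x; exact: ubm].
by apply: ub_le_sup => //; exists m => x; exact: ubm.
Qed.

(* The vertices of the i-th part are the pairs (i, k) with k < s i. *)
Section CompleteMultipartite.
Variables (r : nat) (s : 'I_r -> nat).

Definition Kvertex : finType := {i : 'I_r & 'I_(s i)}.

Definition part (x : Kvertex) : 'I_r := tag x.
Definition pos (x : Kvertex) : nat := nat_of_ord (tagged x).

Definition Kadj : rel Kvertex := fun x y => part x != part y.

Fact Kadj_sym : symmetric Kadj.
Proof. by move=> x y; rewrite /Kadj eq_sym. Qed.

Fact Kadj_irr : irreflexive Kadj.
Proof. by move=> x; rewrite /Kadj eqxx. Qed.

Definition complete_multipartite : sgraph := SGraph Kadj_sym Kadj_irr.

Definition class_edges : {set {set complete_multipartite}} :=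
  [set [set p.1; p.2] | p : Kvertex * Kvertex
                      & (p.1 != p.2) && (part p.1 == part p.2)].

End CompleteMultipartite.

Section AddEdges.
Variables (G : sgraph) (F : {set {set G}}).

Definition add_edges_adj : rel G :=
  fun x y => adj x y || (x != y) && ([set x; y] \in F).

Fact add_edges_sym : symmetric add_edges_adj.
Proof. by move=> x y; rewrite /add_edges_adj adj_sym eq_sym finset.setUC. Qed.

Fact add_edges_irr : irreflexive add_edges_adj.
Proof. by move=> x; rewrite /add_edges_adj adj_irr eqxx. Qed.

Definition add_edges : sgraph := SGraph add_edges_sym add_edges_irr.

End AddEdges.

(* Empty parts (s i = 0) are allowed. *)
Definition multipartite_plus (n r q : nat) (G : sgraph) : Prop :=
  exists s : 'I_r -> nat,
    [/\ {homo s : i j / (i <= j)%N >-> (j <= i)%N},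
        (\sum_(i < r) s i)%N = n &
        exists F : {set {set complete_multipartite s}},
          [/\ F \subset class_edges s, #|F| = q &
              graph_iso G (add_edges F)]].

(* Nonincreasing sizes, so the part of index r.-1 is a smallest one. *)
Definition turan_size (n r : nat) (i : 'I_r) : nat :=
  (n %/ r + (i < n %% r))%N.

Arguments turan_size n r i : clear implicits.

Definition turan (n r : nat) : sgraph :=
  complete_multipartite (turan_size n r).

(* The triangle on {0, 1, 2} if q = 3, the star with centre 0 and leaves
   1, ..., q otherwise. *)
Definition Hadj (q : nat) : rel nat := fun i j =>
  if (q == 3)%N then [&& i != j, i < 3 & j < 3]%N
  else ((i == 0) && (0 < j <= q) || (j == 0) && (0 < i <= q))%N.

(* H is placed on the first vertices of the last part. This set has q elements
   only if that part has at least |V(H)| vertices (q + 1 for a star). *)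
Definition L_edges (n r q : nat) : {set {set turan n r}} :=
  [set [set p.1; p.2] | p : Kvertex (turan_size n r) * Kvertex (turan_size n r)
     & [&& part p.1 == r.-1 :> nat, part p.2 == r.-1 :> nat &
           Hadj q (pos p.1) (pos p.2)]].

Definition Lgraph (n r q : nat) : sgraph := add_edges (L_edges n r q).

(* Main.v *)
Require Import Defs.
From mathcomp Require Import all_boot all_order all_algebra.
From mathcomp Require Import reals topology normedtype.
From mathcomp Require Import ring lra zify.
Set Implicit Arguments.
Unset Strict Implicit.
Unset Printing Implicit Defensive.
Import Order.TTheory GRing.Theory Num.Theory.
Local Open Scope ring_scope.

(* Let lambda exceed a large multiple of q, let H be the graph of class-edges,
   and let y solve lambda y = 1 + H y. An eigenvector for lambda is
   proportional to y on each part, so lambda is an eigenvalue if and only if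
   sum_i 1 / (lambda + n_i + e_i) = (r - 1) / lambda, where n_i is the size of
   the i-th part and e_i is the sum of (H y)_v over it. The total excess
   E = sum_i e_i depends on H only, and counting walks gives
   E = 2q / lambda + (sum_v d_v^2) / lambda^2 + ..., where
   sum_v d_v^2 = q^2 + q - 2 #(pairs of disjoint edges). If H has two disjoint
   edges, then it has at least a constant times q such pairs, and this loss
   outweighs all later terms as well as what convexity of 1 / (lambda + _)
   gains by spreading the excess over several parts. Otherwise H is a star or
   a triangle inside one part; K_3 beats K_{1,3} by explicit formulas. For a
   given E, comparing 1 / (lambda + _) with its chord through n %/ r and
   n %/ r + 1 shows that the sum is least when the parts are balanced and E
   sits in a smallest part. If G is not L, this makes the sum for L at
   lambda(G) strictly smaller than (r - 1) / lambda(G), and the intermediate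
   value theorem produces an eigenvalue of L above lambda(G). *)

(** * Degrees and pairs of disjoint edges *)

Section Degrees.
Variables (T : finType) (H : rel T).
Hypotheses (Hsym : symmetric H) (Hirr : irreflexive H).

Definition deg (v : T) : nat := #|[set u | H v u]|.

Definition is_star c := forall u v, H u v -> (u == c) || (v == c).

Definition is_triangle (A : {set T}) :=
  #|A| = 3%N /\ forall u v, H u v = [&& u != v, u \in A & v \in A].

(** Off the centre, a vertex has degree 1 or 0 according to whether it is adjacent to [c]. *)
Lemma star_sum_deg c : is_star c -> (\sum_v deg v = (deg c).*2)%N.
Proof.
move=> st; rewrite (bigD1 c) //= -addnn; congr (_ + _)%N.
have nbr v w : v != c -> H v w -> w = c.
  by move=> vc /st; rewrite (negPf vc) => /eqP.
rewrite -[RHS]sum1dep_card (bigID (H c)) /=.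
rewrite [X in (_ + X)%N]big1 ?addn0 => [|v /andP[vc Hcv]].
  apply: eq_big => [v|v /andP[vc Hcv]].
    by have [->|//] := eqVneq v c; rewrite Hirr.
  rewrite /deg -(cards1 c); apply: eq_card => w; rewrite !inE.
  by apply/idP/eqP => [/nbr|->]; [exact | rewrite Hsym].
apply/eqP; rewrite cards_eq0; apply/set0Pn => -[w]; rewrite inE => Hvw.
by move: Hcv; rewrite -(nbr _ _ vc Hvw) Hsym Hvw.
Qed.

Lemma triangle_sum_deg A : is_triangle A -> (\sum_v deg v = 6)%N.
Proof.
case=> A3 HA; rewrite (bigID (mem A)) /= [X in (_ + X)%N]big1 => [|v vA].
  rewrite (eq_bigr (fun=> 2%N)) => [|v vA]; first by rewrite sum_nat_const A3.
  have -> : deg v = #|A :\ v|.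
    by apply: eq_card => u; rewrite !inE HA vA eq_sym.
  by have := cardsD1 v A; rewrite vA A3; lia.
by apply/eqP; rewrite cards_eq0; apply/eqP/setP => u; rewrite !inE HA (negPf vA) andbF.
Qed.

Variable q : nat.
Hypothesis sum_deg : (\sum_v deg v = q.*2)%N.

(** With e counting edges inside a set, twice the degree sum over [A] plus 2 e(~: A) equals 2 q + 2
    e(A), and 2 e(A) is at most |A| (|A| - 1). The degree bounds below are the cases |A| <= 4. *)
Lemma deg_set (A : {set T}) :
  ((\sum_(v in A) deg v).*2 + \sum_(v in ~: A) #|[set u in ~: A | H v u]|
   <= q.*2 + #|A| * #|A|.-1)%N.
Proof.
have split_deg v :
    deg v = (#|[set u in A | H v u]| + #|[set u in ~: A | H v u]|)%N.
  rewrite /deg -(cardsID A); congr (_ + _)%N; apply: eq_card => u.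
    by rewrite !inE andbC.
  by rewrite !inE.
have cross : (\sum_(v in A) #|[set u in ~: A | H v u]|
              = \sum_(v in ~: A) #|[set u in A | H v u]|)%N.
  under eq_bigr do rewrite -sum1dep_card.
  under [RHS]eq_bigr do rewrite -sum1dep_card.
  rewrite (exchange_big_dep (mem (~: A))) /=; last by move=> ? ? _ /andP[].
  apply: eq_bigr => v vA; apply: eq_bigl => u; rewrite Hsym.
  rewrite andbC; move: vA; rewrite inE => -> /=; exact: andbC.
have inner : (\sum_(v in A) #|[set u in A | H v u]| <= #|A| * #|A|.-1)%N.
  rewrite -sum_nat_const; apply: leq_sum => v vA.
  rewrite (cardsD1 v A) vA /=; apply: subset_leq_card; apply/subsetP => u.
  by rewrite !inE => /andP[-> Hvu]; rewrite andbT; apply: contraTneq Hvu => ->; rewrite Hirr.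
have tot : (q.*2 = \sum_(v in A) deg v + \sum_(v in ~: A) deg v)%N.
  rewrite -sum_deg (bigID (mem A)) /=; congr (_ + _)%N.
  by apply: eq_bigl => v; rewrite inE.
have eA : (\sum_(v in A) deg v = \sum_(v in A) #|[set u in A | H v u]|
   + \sum_(v in A) #|[set u in ~: A | H v u]|)%N.
  by rewrite -big_split; apply: eq_bigr => v _; exact: split_deg.
have eC : (\sum_(v in ~: A) deg v = \sum_(v in ~: A) #|[set u in A | H v u]|
   + \sum_(v in ~: A) #|[set u in ~: A | H v u]|)%N.
  by rewrite -big_split; apply: eq_bigr => v _; exact: split_deg.
lia.
Qed.

Lemma adj_neq u v : H u v -> u != v.
Proof. by apply: contraTneq => ->; rewrite Hirr. Qed.

Lemma deg_le u : (deg u <= q)%N.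
Proof.
have := deg_set [set u]; rewrite big_set1 cards1 muln0 addn0.
by move=> /(leq_trans (leq_addr _ _)); rewrite leq_double.
Qed.

Lemma deg_pair u v : u != v -> (deg u + deg v <= q.+1)%N.
Proof.
move=> uv; have := deg_set [set u; v].
rewrite big_setU1 ?inE //= big_set1 cards2 uv /=; lia.
Qed.

Lemma deg_triple u v w : u != v -> u != w -> v != w ->
  (deg u + deg v + deg w <= q + 3)%N.
Proof.
move=> uv uw vw; have := deg_set (u |: [set v; w]).
rewrite big_setU1 ?inE ?negb_or ?uv ?uw //= big_setU1 ?inE //= big_set1.
rewrite cardsU1 cards2 vw !inE negb_or uv uw /=; lia.
Qed.

Definition disjoint_edges : bool :=
  [exists u, exists v, exists w, exists z,
   [&& H u v, H w z, u != w, u != z, v != w & v != z]].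

Lemma deg_pair_disjoint u v w z : H u v -> H w z ->
  u != w -> u != z -> v != w -> v != z -> (deg u + deg v <= q)%N.
Proof.
move=> Huv Hwz uw uz vw vz; have := deg_set [set u; v].
rewrite big_setU1 ?inE ?adj_neq //= big_set1 cards2 adj_neq //=.
rewrite (bigD1 w) /=; last by rewrite !inE negb_or !(eq_sym w) uw vw.
(* One end of the disjoint edge is enough: 2 (deg u + deg v) + 1 <= 2 q + 2, and parity does the
   rest. *)
have : (0 < #|[set x in ~: [set u; v] | H w x]|)%N.
  apply/card_gt0P; exists z.
  by rewrite !inE negb_or !(eq_sym z) uz vz.
lia.
Qed.

Lemma deg_quad u v w z : H u v -> H w z ->
  u != w -> u != z -> v != w -> v != z ->
  (deg u + deg v + (deg w + deg z) <= q + 6)%N.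
Proof.
move=> Huv Hwz uw uz vw vz; have := deg_set [set u; v; w; z].
have uv := adj_neq Huv; have wz := adj_neq Hwz.
rewrite -!setUA big_setU1 ?inE ?negb_or ?uv ?uw ?uz //=.
rewrite big_setU1 ?inE ?negb_or ?vw ?vz //= big_setU1 ?inE //= big_set1.
rewrite !cardsU1 cards1 !inE !negb_or uv uw uz vw vz wz /=; lia.
Qed.

(** If neither end of an edge uv covers all edges, some edge vw avoids u and some edge uw' avoids v.
    These meet only if w = w', and then every edge lies inside {u, v, w}. *)
Lemma intersecting_edges : (0 < q)%N -> ~~ disjoint_edges ->
  (exists c, is_star c) \/ (exists A, is_triangle A).
Proof.
move=> q0 nd.
have meet u v w z : H u v -> H w z -> [|| u == w, u == z, v == w | v == z].
  move=> Huv Hwz; apply: contraNT nd; rewrite !negb_or => /and4P[a b c d].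
  apply/existsP; exists u; apply/existsP; exists v.
  by apply/existsP; exists w; apply/existsP; exists z; rewrite Huv Hwz a b c d.
have [u [v Huv]] : exists u v, H u v.
  have : (0 < \sum_v deg v)%N by rewrite sum_deg double_gt0.
  rewrite lt0n sum_nat_eq0 => /forallPn[/= u].
  by rewrite -lt0n => /card_gt0P[v]; rewrite inE => Huv; exists u, v.
have [/forallP su|] := boolP [forall x, forall y, H x y ==> (x == u) || (y == u)].
  by left; exists u => x y; move/forallP/(_ y)/implyP: (su x).
case/forallPn => x /forallPn[y]; rewrite negb_imply negb_or => /and3P[Hxy xu yu].
have [/forallP sv|] := boolP [forall x, forall y, H x y ==> (x == v) || (y == v)].
  by left; exists v => a b; move/forallP/(_ b)/implyP: (sv a).
case/forallPn => z /forallPn[t]; rewrite negb_imply negb_or => /and3P[Hzt zv tv].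
have uv := adj_neq Huv.
have [w [Hvw wu]] : exists w, H v w /\ w != u.
  have := meet _ _ _ _ Huv Hxy; rewrite eq_sym (negPf xu) eq_sym (negPf yu) /=.
  by case/orP => /eqP e; subst v; [exists y | exists x; rewrite Hsym].
have [w' [Huw' wv]] : exists w', H u w' /\ w' != v.
  have := meet _ _ _ _ Huv Hzt; rewrite [v == z]eq_sym (negPf zv) [v == t]eq_sym (negPf tv) /= orbF.
  by case/orP => /eqP e; subst u; [exists t | exists z; rewrite Hsym].
have ww : w' = w.
  have := meet _ _ _ _ Hvw Huw'; rewrite [v == u]eq_sym (negPf uv) [v == w']eq_sym.
  by rewrite (negPf wv) (negPf wu) /= => /eqP.
subst w'; right; exists [set u; v; w].
split; first by rewrite -setUA cardsU1 cards2 !inE negb_or uv [v == w]eq_sym [u == w]eq_sym wu wv.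
have sym3 : forall a b, a \in [set u; v; w] -> b \in [set u; v; w] -> a != b -> H a b.
  move=> a b; rewrite !inE -!orbA => /or3P[] /eqP -> /or3P[] /eqP ->;
  by rewrite ?eqxx //= => _; rewrite // Hsym.
(* An edge with an end outside the triangle would need its other end on all three sides. *)
have inA a b : H a b -> a \in [set u; v; w].
  move=> Hab; rewrite !inE -orbA; apply: contraT; rewrite !negb_or.
  move=> /and3P[/negPf au /negPf av /negPf aw].
  have := meet _ _ _ _ Hab Huv; rewrite au av /= => /orP[] /eqP eb; subst b.
    have := meet _ _ _ _ Hab Hvw.
    by rewrite av aw [u == w]eq_sym (negPf uv) (negPf wu).
  have := meet _ _ _ _ Hab Huw'.
  by rewrite au aw ![v == _]eq_sym (negPf uv) (negPf wv).
move=> a b; apply/idP/and3P => [Hab|[ab aA bA]]; last exact: sym3.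
by split; [exact: adj_neq | exact: inA Hab | apply: (inA b a); rewrite Hsym].
Qed.

End Degrees.

(** * Walk counts and the total excess of the class-edges *)

Section Defect.
Variables (R : realFieldType) (T : finType) (H : rel T).
Hypotheses (Hsym : symmetric H) (Hirr : irreflexive H).
Variable q : nat.
Hypothesis sum_deg : (\sum_v deg H v = q.*2)%N.

Let d v : R := (deg H v)%:R.

Lemma sum_adj_source (f : T -> R) :
  \sum_v \sum_(u | H v u) f v = \sum_v d v * f v.
Proof.
apply: eq_bigr => v _; rewrite sumr_const mulr_natl; congr (_ *+ _).
by apply: eq_card => u; rewrite inE.
Qed.

Lemma sum_adj_swap (f : T -> T -> R) :
  \sum_v \sum_(u | H v u) f v u = \sum_v \sum_(u | H v u) f u v.
Proof.
rewrite (exchange_big_dep predT) //=; apply: eq_bigr => v _.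
by apply: eq_bigl => u; rewrite Hsym.
Qed.

Lemma sum_adj_target (f : T -> R) :
  \sum_v \sum_(u | H v u) f u = \sum_v d v * f v.
Proof. by rewrite sum_adj_swap sum_adj_source. Qed.

Lemma sum_degR : \sum_v d v = 2 * q%:R.
Proof. by rewrite -natr_sum sum_deg -muln2 natrM mulrC. Qed.

(* Twice the number of pairs of disjoint edges. *)
Definition defect : R := q%:R ^+ 2 + q%:R - \sum_v d v ^+ 2.

(** For an edge vu, the number of edges disjoint from it, since d v + d u - 1 edges meet vu. *)
Let t v u : R := q%:R + 1 - d v - d u.

Lemma defectE : 2 * defect = \sum_v \sum_(u | H v u) t v u.
Proof.
under [RHS]eq_bigr do rewrite !sumrB.
rewrite !sumrB sum_adj_source sum_adj_target sum_adj_source -mulr_suml sum_degR.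
by under [X in _ = _ - X - X]eq_bigr do rewrite -expr2; rewrite /defect; ring.
Qed.

Lemma edge_defect_ge0 v u : H v u -> 0 <= t v u.
Proof.
move=> Hvu; have := deg_pair Hsym Hirr sum_deg (adj_neq Hirr Hvu).
by rewrite -(ler_nat R) natrD -natr1 /t -/(d v) -/(d u); lra.
Qed.

(** In the double sum for 2 [defect] these terms occur twice, in the row and in the column of [u];
    all other terms are nonnegative. *)
Lemma defect_row u : \sum_(v | H u v) t u v <= defect.
Proof.
suff : 2 * \sum_(v | H u v) t u v <= 2 * defect by lra.
rewrite defectE mulr_natl mulr2n [leRHS](bigD1 u) //= lerD2l.
rewrite [leRHS](bigID (H u)) /=; apply: (@le_trans _ _ (\sum_(v | (v != u) && H u v) t u v)).
  rewrite (eq_bigl (fun v => (v != u) && H u v)) // => v.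
  by have [->|//] := eqVneq v u; rewrite Hirr.
rewrite -[leLHS]addr0 lerD //.
  apply: ler_sum => v /andP[vu Huv]; rewrite (bigD1 u) ?[H v u]Hsym //=.
  rewrite [t v u](_ : _ = t u v) ?lerDl; last by rewrite /t; ring.
  by apply: sumr_ge0 => w /andP[Hvw _]; exact: edge_defect_ge0.
by apply: sumr_ge0 => v _; apply: sumr_ge0 => w; exact: edge_defect_ge0.
Qed.

(* Each edge at [u] other than [uw] misses all but two of the edges at [w]. *)
Lemma defect_edge u w : H u w -> d u * d w <= defect + 2 * q%:R.
Proof.
move=> Huw; have uw := adj_neq Hirr Huw.
have : (d u - 1) * (d w - 2) <= defect.
  apply: le_trans (defect_row u); rewrite (bigD1 w) //=.
  have := edge_defect_ge0 Huw.
  suff : (d u - 1) * (d w - 2) <= \sum_(i | H u i && (i != w)) t u i by lra.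
  have -> : d u - 1 = \sum_(i | H u i && (i != w)) 1.
    have : d u = \sum_(i | H u i) 1.
      rewrite sumr_const; congr (_ *+ _); by apply: eq_card => i; rewrite inE.
    by rewrite (bigD1 w) //= => ->; ring.
  rewrite mulr_suml; apply: ler_sum => i /andP[Hui iw].
  have := deg_triple Hsym Hirr sum_deg uw (adj_neq Hirr Hui); rewrite eq_sym iw => /(_ isT).
  by rewrite -(ler_nat R) !natrD /t -/(d _); lra.
have := deg_pair Hsym Hirr sum_deg uw; rewrite -(ler_nat R) natrD -natr1 /t -/(d u) -/(d w).
have : 0 <= d w by exact: ler0n.
lra.
Qed.

(** For disjoint edges uv and wz, t u v >= 1 gives defect >= 1, and t u v + t w z >= q - 4 gives 2
    defect >= q - 4. Together q <= 2 defect + 4 <= 6 defect. *)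
Lemma defect_disjoint : disjoint_edges H -> 0 < defect /\ q%:R <= 6 * defect.
Proof.
case/existsP => u /existsP[v /existsP[w /existsP[z /and5P[Huv Hwz uw uz /andP[vw vz]]]]].
have := deg_pair_disjoint Hsym Hirr sum_deg Huv Hwz uw uz vw vz.
have := deg_quad Hsym Hirr sum_deg Huv Hwz uw uz vw vz.
rewrite -!(ler_nat R) !natrD -!/(d _).
have row a b : H a b -> t a b <= defect.
  move=> Hab; apply: le_trans (defect_row a); rewrite (bigD1 b) //= lerDl.
  by apply: sumr_ge0 => c /andP[Hac _]; exact: edge_defect_ge0.
have := row _ _ Huv; have := row _ _ Hwz; rewrite /t; lra.
Qed.

(** Since 2 q <= 12 [defect], the product of degrees along an edge is at most 13 [defect], and there
    are 2 q ordered edges. *)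
Lemma sum_deg_edges : disjoint_edges H ->
  \sum_v \sum_(u | H v u) d v * d u <= 26 * q%:R * defect.
Proof.
move=> /defect_disjoint[D0 Dq].
have -> : 26 * q%:R * defect = \sum_v \sum_(u | H v u) (13 * defect).
  by rewrite sum_adj_source -mulr_suml sum_degR; ring.
by do 2![apply: ler_sum => ? ?]; apply: le_trans (defect_edge _) _ => //; lra.
Qed.

Variables (lam : R) (y : T -> R).
Hypothesis lam_large : 200 * q%:R < lam.

Section Resolvent.
Variables (A : {set T}) (a : R).
Hypothesis closedA : forall v u, v \in A -> H v u -> u \in A.
Hypothesis eq_y : forall v, v \in A -> lam * y v = a + \sum_(u | H v u) y u.

(** At a maximum of |y| on [A], at most [q] neighbours contribute. General [a] and [A] allow three
    uses: a = 1 for the resolvent, a = 0 for uniqueness, and [A] a part for eigenvectors. *)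
Lemma resolvent_bound v : v \in A -> `|y v| * (lam - q%:R) <= `|a|.
Proof.
move=> vA; have ll := lam_large; have q0 : 0 <= q%:R :> R by exact: ler0n.
case: (@arg_maxP _ _ _ v (mem A) (fun v => `|y v|) vA) => m mA max_m.
have H1 : `|y m| * (lam - q%:R) <= `|a|.
  have l0 : 0 <= lam by lra.
  rewrite mulrBr lerBlDr [`|y m| * lam]mulrC -{1}(ger0_norm l0) -normrM eq_y // (le_trans (ler_normD _ _)) // lerD2l.
  apply: (le_trans (ler_norm_sum _ _ _)).
  apply: (@le_trans _ _ (\sum_(u | H m u) `|y m|)).
    by apply: ler_sum => u Hu; apply: max_m; exact: closedA Hu.
  rewrite sumr_const -[leLHS]mulr_natr ler_wpM2l // ler_nat.
  by apply: leq_trans (deg_le Hsym Hirr sum_deg m); apply/eq_leq/eq_card => u; rewrite inE.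
by apply: le_trans H1; apply: ler_wpM2r; [lra | exact: max_m].
Qed.

(** The neighbours contribute at most q a / (lam - q) in absolute value, which is below [a] because
    lam > 2 q. *)
Lemma resolvent_pos v : 0 < a -> v \in A -> 0 < y v.
Proof.
move=> a0 vA; have ll := lam_large; have q0 : 0 <= q%:R :> R by exact: ler0n.
have lq : 0 < lam - q%:R by lra.
suff : 0 < lam * y v by rewrite pmulr_rgt0 //; lra.
have B u : u \in A -> `|y u| <= a / (lam - q%:R).
  by move=> uA; rewrite ler_pdivlMr // -[X in _ <= X]gtr0_norm //; exact: resolvent_bound.
rewrite eq_y //; have : `|\sum_(u | H v u) y u| <= q%:R * (a / (lam - q%:R)).
  apply: (le_trans (ler_norm_sum _ _ _)).
  apply: (@le_trans _ _ (\sum_(u | H v u) a / (lam - q%:R))).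
    by apply: ler_sum => u Hu; apply: B; exact: closedA Hu.
  rewrite sumr_const -[leLHS]mulr_natl ler_wpM2r ?ler_nat ?divr_ge0 //; try lra.
  by apply: leq_trans (deg_le Hsym Hirr sum_deg v); apply/eq_leq/eq_card => u; rewrite inE.
have : q%:R * (a / (lam - q%:R)) < a.
  by rewrite mulrA ltr_pdivrMr // mulrC ltr_pM2l //; lra.
by move=> h1 h2; have := lerNnormlW h2; lra.
Qed.

End Resolvent.

Hypothesis eq_y : forall v, lam * y v = 1 + \sum_(u | H v u) y u.
Hypothesis q_gt0 : (0 < q)%N.

Let q_gt0R : 1 <= q%:R :> R.
Proof. by rewrite ler1n. Qed.

Definition excess : R := \sum_v \sum_(u | H v u) y u.

Lemma y_gt0 v : 0 < y v.
Proof. by apply: (@resolvent_pos setT 1) => // u _; exact: eq_y. Qed.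

Lemma y_le v : y v <= (lam - q%:R)^-1.
Proof.
rewrite -[leRHS]div1r ler_pdivlMr; last by have := lam_large; have := q_gt0R; lra.
rewrite -{1}(gtr0_norm (y_gt0 v)) -[leRHS]normr1.
by apply: (@resolvent_bound setT 1) => // u _; exact: eq_y.
Qed.

(** Substituting the equation for [y] twice produces 2 q lam, the sum of squared degrees, which is
    q^2 + q - defect, and a remainder of at most defect / 2. The remaining loss defect / 2 is at
    least q / 12. *)
Lemma excess_disjoint : disjoint_edges H ->
  lam ^+ 2 * excess <= 2 * q%:R * lam + q%:R ^+ 2 + q%:R - q%:R / 12.
Proof.
move=> dj; have [D0 Dq] := defect_disjoint dj.
have l0 : 0 < lam by have := lam_large; have := q_gt0R; lra.
have lq : 0 < lam - q%:R by have := lam_large; have := q_gt0R; lra.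
have E1 : lam * excess = 2 * q%:R + \sum_v \sum_(u | H v u) d v * y u.
  rewrite /excess sum_adj_target mulr_sumr.
  under eq_bigr => v _ do rewrite mulrCA eq_y mulrDr mulr1 mulr_sumr.
  by rewrite big_split sum_degR.
have E2 : lam ^+ 2 * excess = 2 * q%:R * lam + \sum_v d v ^+ 2
    + \sum_v \sum_(u | H v u) \sum_(w | H u w) d v * y w.
  rewrite expr2 -mulrA E1 mulrDr [lam * (2 * _)]mulrC -addrA; congr (_ + _).
  rewrite mulr_sumr.
  under eq_bigr => v _.
    rewrite mulr_sumr.
    under eq_bigr => u _ do rewrite mulrCA eq_y mulrDr mulr1 mulr_sumr.
    rewrite big_split /=; over.
  rewrite big_split /= sum_adj_source; congr (_ + _).
have E3 : \sum_v \sum_(u | H v u) \sum_(w | H u w) d v * y w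
    <= 26 * q%:R * defect / (lam - q%:R).
  apply: (@le_trans _ _ (\sum_v \sum_(u | H v u) d v * d u / (lam - q%:R))).
    apply: ler_sum => v _; apply: ler_sum => u _.
    rewrite -mulr_sumr -mulrA ler_wpM2l ?ler0n //.
    have -> : d u / (lam - q%:R) = \sum_(w | H u w) (lam - q%:R)^-1.
      rewrite sumr_const mulr_natl; congr (_ *+ _).
      by apply: eq_card => w; rewrite inE.
    by apply: ler_sum => w _; exact: y_le.
  under eq_bigr do rewrite -mulr_suml.
  by rewrite -mulr_suml ler_wpM2r ?sum_deg_edges ?invr_ge0 ?ltW.
(* Here lam - q > 199 q, and 26 / 199 < 1 / 2. *)
have E4 : 26 * q%:R * defect / (lam - q%:R) <= defect / 2.
  rewrite ler_pdivrMr //; have := lam_large; have := q_gt0R; nra.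
have := E2; rewrite /defect in E4 E3 D0 Dq *; lra.
Qed.

(** The value at the centre and the sum [S] over the leaves solve lam y_c = 1 + S and lam S = q + q
    y_c; the excess is S + q y_c. *)
Lemma excess_star c : is_star H c ->
  excess = q%:R * (2 * lam + q%:R + 1) / (lam ^+ 2 - q%:R).
Proof.
move=> st; pose S := \sum_(u | H c u) y u.
have dc : d c = q%:R.
  by congr _%:R; have := star_sum_deg Hsym Hirr st; rewrite sum_deg; lia.
have leaf v : H c v -> \sum_(u | H v u) y u = y c.
  move=> Hcv; rewrite (bigD1 c) ?[H v c]Hsym //= big1 ?addr0 // => u /andP[Hvu uc].
  have := st _ _ Hvu; rewrite (negPf uc) orbF => /eqP vc.
  by move: Hcv; rewrite vc Hirr.
have EE : excess = S + q%:R * y c.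
  rewrite /excess (bigD1 c) //=; congr (_ + _).
  rewrite -dc mulr_natl -sumr_const (bigID (H c)) /= [X in _ + X]big1 ?addr0 => [|v /andP[vc Hcv]].
    apply: eq_big => [v|v /andP[_ Hcv]]; last exact: leaf.
    by rewrite inE; have [->|//] := eqVneq v c; rewrite Hirr.
  rewrite big1 // => w Hvw; have := st _ _ Hvw; rewrite (negPf vc) /= => /eqP wc.
  by move: Hcv; rewrite Hsym -wc Hvw.
have e1 : lam * y c = 1 + S by exact: eq_y.
have e2 : lam * S = q%:R + q%:R * y c.
  rewrite /S mulr_sumr -dc mulr_natl.
  transitivity (\sum_(u | H c u) (1 + y c)).
    by apply: eq_bigr => u Hcu; rewrite eq_y leaf.
  rewrite sumr_const mulrnDl; congr (_ *+ _ + _ *+ _);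
    by apply: eq_card => u; rewrite inE.
have l2 : lam ^+ 2 - q%:R != 0.
  by apply: lt0r_neq0; have := lam_large; have := q_gt0R; nra.
have : excess * (lam ^+ 2 - q%:R) = q%:R * (2 * lam + q%:R + 1).
  have Sc : S = lam * y c - 1 by lra.
  rewrite Sc in e2; have e3 : y c * (lam ^+ 2 - q%:R) = q%:R + lam by lra.
  rewrite EE Sc.
  transitivity ((lam + q%:R) * (y c * (lam ^+ 2 - q%:R)) - (lam ^+ 2 - q%:R)).
    by ring.
  by rewrite e3; ring.
by move=> <-; rewrite mulfK.
Qed.

(** The sum [S] over the triangle satisfies lam S = 3 + 2 S, and the excess is 2 S. *)
Lemma excess_triangle A : is_triangle H A -> 2 < lam -> excess = 6 / (lam - 2).
Proof.
case=> A3 HA l2; pose S := \sum_(u in A) y u.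
have nb v : v \in A -> \sum_(u | H v u) y u = S - y v.
  move=> vA; rewrite /S (bigD1 v vA) /= addrC addrK; apply: eq_bigl => u.
  by rewrite HA vA andbC eq_sym.
have EE : excess = 2 * S.
  rewrite /excess (bigID (mem A)) /= [X in _ + X]big1 ?addr0 => [|v vA].
    rewrite (eq_bigr _ nb) sumrB sumr_const A3 -/S -mulr_natl; ring.
  by rewrite big1 // => u; rewrite HA (negPf vA) andbF.
have e : lam * S = 3 + 2 * S.
  rewrite /S mulr_sumr (eq_bigr (fun v => 1 + S - y v)) => [|v vA].
    rewrite sumrB sumr_const A3 -/S -mulr_natl; ring.
  by rewrite eq_y nb // addrA.
have l20 : lam - 2 != 0 by apply: lt0r_neq0; lra.
apply: (mulIf l20); rewrite divfK // EE; lra.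
Qed.

End Defect.

(** * The secular equation *)

Section Resolvent.
Variables (R : realFieldType) (T : finType) (H : rel T).
Hypotheses (Hsym : symmetric H) (Hirr : irreflexive H).
Variable q : nat.
Hypothesis sum_deg : (\sum_v deg H v = q.*2)%N.
Variable lam : R.
Hypothesis lam_large : 200 * q%:R < lam.

Definition resolvent (y : T -> R) := forall v, lam * y v = 1 + \sum_(u | H v u) y u.

Lemma mulmx_enum (m : T -> T -> R) (w : 'rV[R]_#|T|) v :
  (w *m \matrix_(i, j) m (enum_val i) (enum_val j)) 0 (enum_rank v)
  = \sum_u w 0 (enum_rank u) * m u v.
Proof.
rewrite mxE (reindex _ (onW_bij _ (@enum_rank_bij T))) /=.
by apply: eq_bigr => u _; rewrite !mxE !enum_rankK.
Qed.

(** A kernel vector of lam - H solves the equation with a = 0, so the bound makes it vanish and the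
    matrix is invertible. *)
Lemma resolvent_ex : exists y, resolvent y.
Proof.
pose m u v : R := lam *+ (u == v) - (H u v)%:R.
pose M : 'M[R]_#|T| := \matrix_(i, j) m (enum_val i) (enum_val j).
have ME (w : 'rV_#|T|) v : (w *m M) 0 (enum_rank v) =
    lam * w 0 (enum_rank v) - \sum_(u | H v u) w 0 (enum_rank u).
  rewrite mulmx_enum /m; under eq_bigr do rewrite mulrBr.
  rewrite sumrB; congr (_ - _).
    rewrite (bigD1 v) //= eqxx mulr1n mulrC big1 ?addr0 // => u /negPf ->.
    by rewrite mulr0n mulr0.
  rewrite [RHS]big_mkcond; apply: eq_bigr => u _; rewrite Hsym.
  by case: ifP; rewrite ?mulr1 ?mulr0.
have Mu : M \in unitmx.
  rewrite -row_free_unit -kermx_eq0; apply/eqP; apply/row_matrixP => i; rewrite row0.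
  set w := row i _; have wM : w *m M = 0 by rewrite -row_mul mulmx_ker row0.
  have := @resolvent_bound R T H Hsym Hirr q sum_deg lam (fun v => w 0 (enum_rank v)) lam_large
     setT 0 (fun _ _ _ _ => in_setT _).
  have e v : v \in setT -> lam * w 0 (enum_rank v) = 0 + \sum_(u | H v u) w 0 (enum_rank u).
    by move=> _; rewrite add0r; apply/eqP; rewrite -subr_eq0 -ME wM mxE.
  move=> /(_ e) b; apply/rowP => j; rewrite [RHS]mxE; have := b (enum_val j) (in_setT _).
  rewrite enum_valK normr0 pmulr_lle0; last first.
    by have := lam_large; have := ler0n R q; lra.
  by rewrite normr_le0 => /eqP.
exists (fun v => (const_mx 1 *m invmx M : 'rV_#|T|) 0 (enum_rank v)) => v.
apply/eqP; rewrite -subr_eq; rewrite -ME mulmxKV // mxE; exact: eqxx.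
Qed.

Variables (r : nat) (p : T -> 'I_r).
Hypothesis Hp : forall u v, H u v -> p u = p v.

Definition psize i := #|[set v | p v == i]|.
Definition pexcess (y : T -> R) i := \sum_(v | p v == i) \sum_(u | H v u) y u.

Let closed_part i v u : v \in [set v | p v == i] -> H v u -> u \in [set v | p v == i].
Proof. by rewrite !inE => /eqP <- /Hp ->. Qed.

Let lam_gt0 : 0 < lam.
Proof. by have := lam_large; have := ler0n R q; lra. Qed.

Let lam_q : 0 < lam - q%:R.
Proof. by have := lam_large; have := ler0n R q; lra. Qed.

Lemma resolvent_part y i : resolvent y ->
  lam * \sum_(v | p v == i) y v = (psize i)%:R + pexcess y i.
Proof.
move=> ey; rewrite mulr_sumr (eq_bigr _ (fun v _ => ey v)) big_split /=; congr (_ + _).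
by rewrite sumr_const; congr (_ *+ _); apply: eq_card => v; rewrite inE.
Qed.

(** With S the total weight and c_i the weight outside part i, [x] equals c_i y on part i, so lam +
    n_i + e_i = lam S / c_i; the c_i add up to (r - 1) S. The work lies in showing that S and all
    c_i are nonzero. *)
Lemma secular_eq (x : T -> R) : (exists v, x v != 0) ->
  (forall v, lam * x v = \sum_(u | p v != p u) x u + \sum_(u | H v u) x u) ->
  exists2 y, resolvent y &
    \sum_i (lam + (psize i)%:R + pexcess y i)^-1 = (r%:R - 1) / lam.
Proof.
case=> v0 xv0 ex; pose S := \sum_v x v; pose Sp i := \sum_(v | p v == i) x v.
pose c i := S - Sp i.
have SE : S = \sum_i Sp i by rewrite /S (partition_big p predT).
have xE i v : v \in [set v | p v == i] -> lam * x v = c i + \sum_(u | H v u) x u.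
  rewrite inE => /eqP <-; rewrite ex; congr (_ + _).
  rewrite /c /S /Sp [X in X - _](bigID (fun u => p u == p v)) /= addrC addrK.
  by apply: eq_bigl => u; rewrite eq_sym.
have c0 i : c i = 0 -> Sp i = 0.
  move=> ci; rewrite /Sp big1 // => v pv.
  have := @resolvent_bound R T H Hsym Hirr q sum_deg lam x lam_large _ _ (@closed_part i) (@xE i) v.
  by rewrite inE => /(_ pv); rewrite ci normr0 pmulr_lle0 // normr_le0 => /eqP.
(* If S = 0 then c_i = - Sp i, while positivity gives [x] the sign of c_i on part i. So every Sp i
   vanishes, hence every c_i, and then x = 0. *)
have S0 : S != 0.
  apply/eqP => S0; have Sp0 i : Sp i = 0.
    case: (ltgtP (Sp i) 0) => // Si.
      suff : 0 <= Sp i by rewrite leNgt Si.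
      apply: sumr_ge0 => v pv; apply/ltW.
      apply: (@resolvent_pos R T H Hsym Hirr q sum_deg lam x lam_large _ _ (@closed_part i) (@xE i) v).
        by rewrite /c S0 sub0r oppr_gt0.
      by rewrite inE.
    suff : 0 <= - Sp i by rewrite oppr_ge0 leNgt Si.
    rewrite /Sp -sumrN; apply: sumr_ge0 => v pv; apply/ltW.
    have xEN u : u \in [set v | p v == i] -> lam * - x u = - c i + \sum_(w | H u w) - x w.
      by move=> /xE; rewrite mulrN => ->; rewrite opprD sumrN.
    apply: (@resolvent_pos R T H Hsym Hirr q sum_deg lam (fun v => - x v) lam_large _ _ (@closed_part i) xEN v).
      by rewrite /c S0 sub0r opprK.
    by rewrite inE.
  have := @resolvent_bound R T H Hsym Hirr q sum_deg lam x lam_large _ _ (@closed_part (p v0)) (@xE (p v0)) v0.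
  rewrite inE eqxx => /(_ isT); rewrite /c S0 Sp0 subr0 normr0 pmulr_lle0 // normr_le0.
  exact/negP.
have cn i : c i != 0.
  apply/eqP => ci; have := ci; rewrite /c c0 // subr0; exact/eqP.
have ey : resolvent (fun v => x v / c (p v)).
  move=> v; rewrite mulrA (xE (p v)) ?inE // mulrDl divff //; congr (_ + _).
  by rewrite mulr_suml; apply: eq_bigr => u /Hp ->.
exists (fun v => x v / c (p v)) => //.
have E i : (lam + (psize i)%:R + pexcess (fun v => x v / c (p v)) i)^-1 = c i / (lam * S).
  rewrite -addrA -resolvent_part //.
  have -> : \sum_(v | p v == i) x v / c (p v) = Sp i / c i.
    by rewrite /Sp mulr_suml; apply: eq_bigr => v /eqP ->.
  have -> : lam + lam * (Sp i / c i) = (lam * S) / c i.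
    have -> : S = c i + Sp i by rewrite /c subrK.
    by field; exact: cn.
  by rewrite invf_div.
under eq_bigr do rewrite E.
rewrite -mulr_suml /c sumrB -SE sumr_const card_ord -mulr_natl.
have := lt0r_neq0 lam_gt0 => l0.
by field; rewrite S0 l0.
Qed.

Lemma secular_eigen y : resolvent y -> (forall i, 0 < lam + (psize i)%:R + pexcess y i) ->
    \sum_i (lam + (psize i)%:R + pexcess y i)^-1 = (r%:R - 1) / lam ->
  exists2 x : T -> R, (forall v, x v != 0) &
  (forall v, lam * x v = \sum_(u | p v != p u) x u + \sum_(u | H v u) x u).
Proof.
(* The factors c_i of the other direction, for total weight S = 1. *)
move=> ey g0 sec; pose c i := lam / (lam + (psize i)%:R + pexcess y i).
have l0 := lt0r_neq0 lam_gt0.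
pose x v := y v * c (p v).
have c_gt0 i : 0 < c i by rewrite divr_gt0.
have SpE i : \sum_(v | p v == i) x v = 1 - c i.
  rewrite /x (eq_bigr (fun v => y v * c i)) => [|v /eqP -> //].
  rewrite -mulr_suml; apply: (mulfI l0); rewrite mulrA resolvent_part // /c.
  by field; rewrite lt0r_neq0.
have SE : \sum_v x v = 1.
  rewrite (partition_big p predT) //=; under eq_bigr do rewrite SpE.
  rewrite sumrB sumr_const card_ord /c -mulr_sumr sec -[1 *+ r]/(r%:R).
  by field.
exists x => v.
  rewrite /x lt0r_neq0 // mulr_gt0 //.
  by apply: (@resolvent_pos R T H Hsym Hirr q sum_deg lam y lam_large setT 1).
have -> : \sum_(u | p v != p u) x u = c (p v).
  have := SE; rewrite (bigID (fun u => p u == p v)) /= SpE.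
  under [X in _ + X = _]eq_bigl do rewrite eq_sym.
  by move=> h; lra.
rewrite /x mulrA ey mulrDl mul1r mulr_suml; congr (_ + _).
by apply: eq_bigr => u /Hp ->.
Qed.

End Resolvent.

(** * Convexity *)

Section Inequalities.
Variable R : realFieldType.
Implicit Types (lam c e E : R) (q b k r m : nat).

(** Equal to 1 / c - 1 / (c + e), the loss in 1 / c caused by an excess e. *)
Definition delta c e := e / (c * (c + e)).

(** The closed form of the excess when the class-edges form a star. *)
Definition star_value q lam := q%:R * (2 * lam + q%:R + 1) / (lam ^+ 2 - q%:R).

(* The excess of the class-edges of L. *)
Definition best_excess q lam := if q == 3%N then 6 / (lam - 2) else star_value q lam.

(* The sum of [1 / (lam + n_i + e_i)] when [k] parts have size [b + 1], the
   others have size [b], and all the excess [e] is in a part of size [b]. *)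
Definition turan_secular r b k lam e :=
  r%:R / (lam + b%:R) - k%:R / ((lam + b%:R) * (lam + b%:R + 1))
  - delta (lam + b%:R) e.

(* The chord through [b] and [b + 1] lies below the convex function
   [1 / (lam + _)] at every integer. *)
Lemma chord_le lam b m e : 0 < lam -> 0 <= e < 1 ->
  let c := lam + b%:R in
  c^-1 - (m%:R - b%:R) / (c * (c + 1)) - delta c e <= (lam + m%:R + e)^-1
  ?= iff ((m == b) || (m == b.+1) && (e == 0)).
Proof.
move=> l0 /andP[e0 e1] c; have b0 := ler0n R b; have m0 := ler0n R m.
have c0 : 0 < c by rewrite /c; lra.
pose j : R := m%:R - b%:R; pose X := lam + m%:R + e.
have X0 : 0 < X by rewrite /X; lra.
pose B := c * (j + 2 * e - 1) + e * (j + e).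
have XE : X = c + j + e by rewrite /X /c /j; ring.
(* As j is an integer and 0 <= e < 1, the factor [B] has the sign of j unless j is 0 or 1; at j = 1
   it is e (2 c + 1 + e). This also yields the equality case. *)
have dE : X^-1 - (c^-1 - j / (c * (c + 1)) - delta c e)
    = j * B / ((c + e) * X * (c * (c + 1))).
  rewrite /delta /B; have := lt0r_neq0 X0; rewrite XE => X0'.
  by field; rewrite X0' !lt0r_neq0 //; lra.
have den : 0 < (c + e) * X * (c * (c + 1)) by rewrite !mulr_gt0 //; lra.
have key : 0 <= j * B ?= iff ((m == b) || (m == b.+1) && (e == 0)).
  have [mb|mb|mb] := ltngtP m b; last 1 first.
  - by rewrite /j mb subrr mul0r; exact/leif_refl.
  - have j1 : j <= -1 by move: mb; rewrite -(ler_nat R) -natr1 /j; lra.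
    rewrite (_ : (m == b.+1) = false) /=; last by apply/eqP; lia.
    have B0 : B < 0 by rewrite /B; nra.
    by apply/leifP; nra.
  have [mb1|m1] := eqVneq m b.+1 => /=.
    have j1 : j = 1 by rewrite /j mb1 -natr1; ring.
    have -> : j * B = e * (2 * c + 1 + e) by rewrite /B j1; ring.
    apply/leifP; case: eqP => [->|/eqP en0]; first by rewrite mul0r.
    by rewrite mulr_gt0 //; lra.
  have j2 : 2 <= j.
    have : (b + 2 <= m)%N by move/eqP: m1; lia.
    by rewrite -(ler_nat R) natrD /j; lra.
  by apply/leifP; have B0 : 0 < B by [rewrite /B; nra]; nra.
split.
  rewrite -subr_ge0 dE divr_ge0 //; [by case: key | exact: ltW].
rewrite eq_sym -subr_eq0 dE mulf_eq0 invr_eq0 (gt_eqF den) orbF eq_sym.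
by case: key.
Qed.

(** * Estimates for the largest possible excess *)

Section Excess.
Variables (q : nat) (lam : R).
Hypotheses (q_gt0 : (0 < q)%N) (lam_large : 200 * q%:R < lam).

Let q1 : 1 <= q%:R :> R. Proof. by rewrite ler1n. Qed.

Lemma star_value_ge : 2 * q%:R * lam + q%:R ^+ 2 + q%:R <= lam ^+ 2 * star_value q lam.
Proof.
have ll := lam_large; have q1' := q1.
rewrite /star_value mulrA ler_pdivlMr; last by nra.
have : 0 <= q%:R * (2 * q%:R * lam + q%:R ^+ 2 + q%:R) by rewrite mulr_ge0 //; nra.
by lra.
Qed.

Lemma star_value_le : star_value q lam * lam <= 3 * q%:R.
Proof.
have ll := lam_large; have q1' := q1.
rewrite /star_value mulrAC ler_pdivrMr; last by nra.
have h : (2 * lam + q%:R + 1) * lam <= 3 * (lam ^+ 2 - q%:R) by nra.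
by have := ler_wpM2l (ler0n R q) h; lra.
Qed.

(** For q = 3 this amounts to 6 (lam + 2) (lam - 2) < 6 (lam^2 - 3), that is, -24 < -18. *)
Lemma star_value_best : star_value q lam <= best_excess q lam ?= iff (q != 3%N).
Proof.
rewrite /best_excess; case: eqP => [q3|_] /=; last exact/leif_refl.
have ll := lam_large; have q1' := q1.
apply/leifP; rewrite /star_value q3; rewrite q3 in ll.
rewrite ltr_pdivrMr; last by nra.
rewrite mulrAC ltr_pdivlMr; last lra.
by nra.
Qed.

Lemma best_excess_le : best_excess q lam * lam <= 3 * q%:R.
Proof.
rewrite /best_excess; case: eqP => [q3|_]; last exact: star_value_le.
have ll := lam_large; rewrite q3 in ll *.
by rewrite mulrAC ler_pdivrMr; lra.
Qed.

Lemma best_excess_gt0 : 0 < best_excess q lam.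
Proof.
apply: lt_le_trans star_value_best.1.
have ll := lam_large; have q1' := q1.
by rewrite /star_value divr_gt0 //; nra.
Qed.

Lemma best_excess_lt1 : best_excess q lam < 1.
Proof.
have ll := lam_large; have q1' := q1; have := best_excess_le.
have := best_excess_gt0; nra.
Qed.

(** By [delta_le] the left side bounds the total loss however E is split over the parts. With B the
    best excess, the claim is E B < c (B - E): here lam^2 E B <= 9 q^2, while lam^2 (B - E) >= q /
    12 and c >= lam > 200 q. *)
Lemma delta_gap c E : lam <= c -> 0 <= E ->
  lam ^+ 2 * E <= 2 * q%:R * lam + q%:R ^+ 2 + q%:R - q%:R / 12 ->
  E / c ^+ 2 < delta c (best_excess q lam).
Proof.
move=> lc E0 hE; have ll := lam_large; have q1' := q1.
set B := best_excess q lam.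
have B0 : 0 < B := best_excess_gt0.
have BS : star_value q lam <= B := star_value_best.1.
have B3 : B * lam <= 3 * q%:R := best_excess_le.
have l0 : 0 < lam by lra.
have g : q%:R / 12 <= lam ^+ 2 * (B - E).
  have := star_value_ge; have : lam ^+ 2 * star_value q lam <= lam ^+ 2 * B.
    by rewrite ler_wpM2l // exprn_ge0 // ltW.
  by lra.
have EB : E < B.
  by rewrite -subr_gt0 -(pmulr_rgt0 _ (exprn_gt0 2 l0)); lra.
have EE : lam ^+ 2 * (E * B) <= 9 * q%:R ^+ 2.
  apply: (@le_trans _ _ ((B * lam) ^+ 2)).
    by rewrite [leRHS](_ : _ = lam ^+ 2 * (B * B)) ?ler_wpM2l ?ler_wpM2r ?exprn_ge0 ?ltW //; ring.
  have -> : 9 * q%:R ^+ 2 = (3 * q%:R) ^+ 2 :> R by ring.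
  by rewrite ler_pXn2r // nnegrE ?mulr_ge0 // ?ltW //; lra.
have : E * B < c * (B - E).
  rewrite -(ltr_pM2l (exprn_gt0 2 l0)) (le_lt_trans EE) //.
  apply: (@lt_le_trans _ _ (lam * (q%:R / 12))); first by nra.
  have q12 : 0 <= q%:R / 12 :> R by lra.
  by have := ler_pM (ltW l0) q12 lc g; lra.
have c0 : 0 < c by lra.
rewrite /delta => h; rewrite ltr_pdivrMr; last exact: exprn_gt0.
rewrite mulrAC ltr_pdivlMr; last by rewrite mulr_gt0; lra.
have : E * (c + B) < B * c by lra.
by rewrite -(ltr_pM2l c0); lra.
Qed.

End Excess.

Lemma delta_le c e : 0 < c -> 0 <= e -> delta c e <= e / c ^+ 2.
Proof.
move=> c0 e0; rewrite /delta ler_wpM2l // lef_pV2 ?posrE ?mulr_gt0 ?exprn_gt0 //; last lra.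
by rewrite expr2 ler_pM2l //; lra.
Qed.

Lemma delta_lt c e e' : 0 < c -> 0 <= e < e' -> delta c e < delta c e'.
Proof.
move=> c0 /andP[e0 ee]; rewrite /delta ltr_pdivrMr; last by rewrite mulr_gt0; lra.
rewrite mulrAC ltr_pdivlMr; last by rewrite mulr_gt0; lra.
have : 0 < c * c * (e' - e) by rewrite !mulr_gt0 //; lra.
by lra.
Qed.

(** The chord bound is summed over the parts: its linear terms see only the sum of s_i - b, which is
    k, and equality must hold in every part. *)
Lemma secular_lower r b k lam (s : 'I_r -> nat) (e : 'I_r -> R) : 0 < lam ->
  (\sum_i s i = r * b + k)%N -> (forall i, 0 <= e i < 1) ->
  let c := lam + b%:R in
  r%:R / c - k%:R / (c * (c + 1)) - \sum_i delta c (e i)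
    <= \sum_i (lam + (s i)%:R + e i)^-1
  ?= iff [forall i, (s i == b) || (s i == b.+1) && (e i == 0)].
Proof.
move=> l0 ss e01 c.
have -> : r%:R / c - k%:R / (c * (c + 1)) - \sum_i delta c (e i) =
    \sum_(i < r) (c^-1 - ((s i)%:R - b%:R) / (c * (c + 1)) - delta c (e i)).
  rewrite !sumrB -mulr_suml sumrB -natr_sum ss !sumr_const card_ord natrD natrM.
  by rewrite -(mulr_natl c^-1) -(mulr_natl b%:R); ring.
by apply: leif_sum => i _; exact: chord_le.
Qed.

End Inequalities.

(** * Comparison of an arbitrary graph with L at one lambda *)

Definition best_class_edges (T : finType) (H : rel T) (q : nat) : Prop :=
  if q == 3%N then exists A, is_triangle H A else exists c, is_star H c.

Section Comparison.
Variables (R : realFieldType) (T : finType) (H : rel T).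
Hypotheses (Hsym : symmetric H) (Hirr : irreflexive H).
Variable q : nat.
Hypotheses (q_gt0 : (0 < q)%N) (sum_deg : (\sum_v deg H v = q.*2)%N).
Variables (r : nat) (p : T -> 'I_r).
Hypothesis Hp : forall u v, H u v -> p u = p v.

Lemma triangle_card A : is_triangle H A -> q = 3%N.
Proof.
by move=> /triangle_sum_deg; rewrite sum_deg; lia.
Qed.

(** Any two edges of a star or a triangle meet, and each edge stays inside its part. *)
Lemma single_part : (exists c, is_star H c) \/ (exists A, is_triangle H A) ->
  exists j, forall u v, H u v -> p u = j.
Proof.
case=> [[c st]|[A [A3 HA]]].
  exists (p c) => u v Huv; case/orP: (st _ _ Huv) => /eqP <- //; exact: Hp Huv.
have /card_gt0P[a aA] : (0 < #|A|)%N by rewrite A3.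
exists (p a) => u v; rewrite HA => /and3P[_ uA _].
by have [->//|ua] := eqVneq u a; apply: Hp; rewrite HA ua uA.
Qed.

Variables (lam : R) (y : T -> R).
Hypothesis lam_large : 200 * q%:R < lam.
Hypothesis eq_y : resolvent H lam y.

Let q1 : 1 <= q%:R :> R. Proof. by rewrite ler1n. Qed.

Lemma pexcess_ge0 i : 0 <= pexcess H p y i.
Proof. by do 2![apply: sumr_ge0 => ? _]; apply: ltW; apply: (y_gt0 Hsym Hirr sum_deg lam_large). Qed.

Lemma sum_pexcess : \sum_i pexcess H p y i = excess H y.
Proof. by rewrite /excess (partition_big p predT). Qed.

Lemma pexcess_single j : (forall u v, H u v -> p u = j) ->
  forall i, pexcess H p y i = if i == j then excess H y else 0.
Proof.
move=> Hj; have z i : i != j -> pexcess H p y i = 0.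
  move=> ij; rewrite /pexcess big1 // => v /eqP pv; rewrite big1 // => u Hvu.
  by move: ij; rewrite -pv (Hj _ _ Hvu) eqxx.
move=> i; case: eqVneq => [->|]; last exact: z.
by rewrite -sum_pexcess (bigD1 j) //= big1 ?addr0 // => a aj; exact: z.
Qed.

Lemma best_excessE : best_class_edges H q -> excess H y = best_excess q lam.
Proof.
have ll := lam_large; have q1' := q1.
rewrite /best_class_edges /best_excess; case: ifP => _ [c].
  by move=> tr; apply: (excess_triangle eq_y tr); lra.
exact: excess_star.
Qed.

Lemma excess_le_best : excess H y <= best_excess q lam.
Proof.
have ll := lam_large; have q1' := q1.
have [sb _] := star_value_best q_gt0 lam_large.
have [dj|ndj] := boolP (disjoint_edges H).
  have h := excess_disjoint Hsym Hirr sum_deg lam_large eq_y q_gt0 dj.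
  have h' := star_value_ge q_gt0 lam_large.
  apply: le_trans sb; rewrite -(ler_pM2l (_ : 0 < lam ^+ 2)); last by rewrite exprn_gt0; lra.
  lra.
case: (intersecting_edges Hsym Hirr sum_deg q_gt0 ndj) => [[c st]|[A tr]].
  by rewrite (excess_star Hsym Hirr sum_deg lam_large eq_y q_gt0 st).
rewrite best_excessE // /best_class_edges (triangle_card tr); by exists A.
Qed.

(** The first alternative collects every case in which some estimate is strict. The second is
    equality throughout, which fixes the class-edges, the part that carries them and the part
    sizes. *)
Lemma secular_compare b k : (\sum_i psize p i = r * b + k)%N ->
  \sum_i (lam + (psize p i)%:R + pexcess H p y i)^-1 = (r%:R - 1) / lam ->
  turan_secular r b k lam (best_excess q lam) < (r%:R - 1) / lam \/
  best_class_edges H q /\ exists j,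
   [/\ forall u v, H u v -> p u = j, psize p j = b &
       forall i, psize p i = b \/ psize p i = b.+1].
Proof.
move=> ss sec; have ll := lam_large; have q1' := q1; have b0 := ler0n R b.
set B := best_excess q lam.
have l0 : 0 < lam by lra.
have pe i : 0 <= pexcess H p y i < 1.
  rewrite pexcess_ge0 (le_lt_trans _ (best_excess_lt1 q_gt0 lam_large)) //.
  apply: le_trans excess_le_best; rewrite -sum_pexcess (bigD1 i) //= lerDl.
  by apply: sumr_ge0 => a _; exact: pexcess_ge0.
have [lo /esym eqlo] := secular_lower l0 ss pe; rewrite sec in lo eqlo.
have E0 : 0 <= excess H y by rewrite -sum_pexcess; apply: sumr_ge0 => i _; exact: pexcess_ge0.
have c0 : 0 < lam + b%:R by lra.
have [dj|ndj] := boolP (disjoint_edges H).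
  left; apply: lt_le_trans lo; rewrite /turan_secular ltrD2l ltrN2.
  have h := excess_disjoint Hsym Hirr sum_deg lam_large eq_y q_gt0 dj.
  apply: le_lt_trans (delta_gap q_gt0 lam_large _ E0 h); last lra.
  rewrite -sum_pexcess mulr_suml; apply: ler_sum => i _.
  by apply: delta_le => //; exact: pexcess_ge0.
have st := intersecting_edges Hsym Hirr sum_deg q_gt0 ndj.
have [j Hj] := single_part st.
have pj := pexcess_single Hj.
have dE : \sum_i delta (lam + b%:R) (pexcess H p y i) = delta (lam + b%:R) (excess H y).
  rewrite (bigD1 j) //= pj eqxx big1 ?addr0 // => i /negPf ij.
  by rewrite pj ij /delta mul0r.
rewrite dE in lo eqlo.
have [EB|EB] := ltrP (excess H y) B.
  left; apply: lt_le_trans lo; rewrite /turan_secular ltrD2l ltrN2.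
  by apply: delta_lt => //; rewrite E0.
have EB' : excess H y = B by apply/eqP; rewrite eq_le EB excess_le_best.
have best : best_class_edges H q.
  (* For q = 3 a star is excluded because its excess is strictly below [B]; for other q a triangle
     has the wrong number of edges. *)
  rewrite /best_class_edges; case: eqP => q3.
    case: st => // -[c st].
    have := excess_star Hsym Hirr sum_deg lam_large eq_y q_gt0 st.
    rewrite EB' -/(star_value q lam) => h.
    have := star_value_best q_gt0 lam_large; rewrite -h => -[_].
    by rewrite eqxx q3.
  case: st => // -[A] /triangle_card; lia.
rewrite EB' in lo eqlo.
have [eqv|nev] := eqVneq (turan_secular r b k lam B) ((r%:R - 1) / lam); last first.
  by left; rewrite lt_neqAle nev.
right; split => //; exists j.
move: eqlo; rewrite -/(turan_secular r b k lam B) eqv eqxx => /forallP szs.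
split => // [|i]; last first.
  by case/orP: (szs i) => [/eqP|/andP[/eqP]]; [left | right].
(* Size b + 1 would force zero excess in part [j], which carries all of B > 0. *)
case/orP: (szs j) => [/eqP//|/andP[_]]; rewrite pj eqxx EB'.
by rewrite gt_eqF // (best_excess_gt0 q_gt0 lam_large).
Qed.

(** The equality case of the chord bound evaluates the sum exactly; this is what applies to L. *)
Lemma best_secular b k : (\sum_i psize p i = r * b + k)%N ->
  best_class_edges H q -> forall j, (forall u v, H u v -> p u = j) -> psize p j = b ->
  (forall i, psize p i = b \/ psize p i = b.+1) ->
  \sum_i (lam + (psize p i)%:R + pexcess H p y i)^-1 =
  turan_secular r b k lam (best_excess q lam).
Proof.
move=> ss best j Hj sj szs; have ll := lam_large; have q1' := q1.
have pj := pexcess_single Hj; rewrite best_excessE // in pj.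
have B0 := best_excess_gt0 q_gt0 lam_large.
have B1 := best_excess_lt1 q_gt0 lam_large.
have pe i : 0 <= pexcess H p y i < 1.
  by rewrite pj; case: ifP => _; rewrite ?lexx ?ltr01 // B1 ltW.
have l0 : 0 < lam by lra.
have [_ ] := secular_lower l0 ss pe.
have -> : [forall i, (psize p i == b) || (psize p i == b.+1) && (pexcess H p y i == 0)].
  apply/forallP => i; rewrite pj; case: (eqVneq i j) => [->|_]; first by rewrite sj eqxx.
  by case: (szs i) => ->; rewrite !eqxx ?orbT.
move/eqP => <-; rewrite /turan_secular; congr (_ - _).
rewrite (bigD1 j) //= pj eqxx big1 ?addr0 // => i /negPf ij.
by rewrite pj ij /delta mul0r.
Qed.

End Comparison.

(** * Eigenvalues of L *)

Section TuranEigenvalue.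
Variables (R : realType) (r b k q : nat).
Hypotheses (q_gt0 : (0 < q)%N).

(** The factor x turns the right-hand side of the secular equation into the constant r - 1. *)
Let f (x : R) := x * turan_secular r b k x (best_excess q x).

Import numFieldNormedType.Exports.
Local Open Scope classical_set_scope.

Lemma turan_secular_continuous x : 200 * q%:R < x -> {for x, continuous f}.
Proof.
move=> xq; have q1 : 1 <= q%:R :> R by rewrite ler1n.
have b0 := ler0n R b.
have B0 := best_excess_gt0 q_gt0 xq.
have cst (a : R) : {for x, continuous (fun=> a)} by exact: cst_continuous.
have idc : {for x, continuous (fun z : R => z)} by by move=> ?; exact: cvg_id.
have addc (g h : R -> R) : {for x, continuous g} -> {for x, continuous h} ->
    {for x, continuous (fun z => g z + h z)} by move=> ? ?; exact: continuousD.
have oppc (g : R -> R) : {for x, continuous g} ->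
    {for x, continuous (fun z => - g z)} by move=> ?; exact: continuousN.
have mulc (g h : R -> R) : {for x, continuous g} -> {for x, continuous h} ->
    {for x, continuous (fun z => g z * h z)} by move=> ? ?; exact: continuousM.
have invc (g : R -> R) : g x != 0 -> {for x, continuous g} ->
    {for x, continuous (fun z => (g z)^-1)} by move=> ? ?; exact: continuousV.
have bc : {for x, continuous (fun z => best_excess q z)}.
  rewrite /best_excess /star_value; case: (q == 3)%N.
    apply: (@mulc) => //; apply: (@invc); last by apply: (@addc).
    by apply: lt0r_neq0; lra.
  apply: (@mulc); first by apply: (@mulc) => //; do 2!apply: (@addc) => //; apply: (@mulc).
  apply: (@invc); first by apply: lt0r_neq0; nra.
  by apply: (@addc) => //; apply: (@mulc).
have cc : {for x, continuous (fun z : R => z + b%:R)} by apply: (@addc).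
apply: (@mulc) => //; apply: (@addc).
  apply: (@addc); first by apply: (@mulc) => //; apply: (@invc) => //; apply: lt0r_neq0; lra.
  apply: (@oppc); apply: (@mulc) => //; apply: (@invc); last by apply: (@mulc) => //; apply: (@addc).
  by rewrite mulf_neq0 // lt0r_neq0 //; lra.
apply: (@oppc); apply: (@mulc) => //; apply: (@invc); last by apply: (@mulc) => //; apply: (@addc).
by rewrite mulf_neq0 // lt0r_neq0 //; lra.
Qed.

(** With c = x + b, each correction is at most its numerator over c, so f x >= r - (r b + k + 1) /
    c, and c >= r b + k + 1. *)
Lemma turan_secular_large x : 200 * q%:R < x -> r%:R * b%:R + k%:R + 1 <= x ->
  r%:R - 1 <= f x.
Proof.
move=> xq xl; have q1 : 1 <= q%:R :> R by rewrite ler1n.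
have b0 := ler0n R b; have k0 := ler0n R k; have r0 := ler0n R r.
have B0 := best_excess_gt0 q_gt0 xq; have B1 := best_excess_lt1 q_gt0 xq.
rewrite /f /turan_secular /delta; set B := best_excess q x in B0 B1 *.
set c := x + b%:R; have c0 : 0 < c by rewrite /c; lra.
have x0 : 0 < x by lra.
have cx : c^-1 <= x^-1 by rewrite lef_pV2 ?posrE // /c lerDl.
have h1 : x * (r%:R / c) = r%:R - r%:R * b%:R / c.
  by rewrite /c; field; rewrite lt0r_neq0.
have xc1 : x / c <= 1 by rewrite ler_pdivrMr // mul1r /c lerDl.
have h2 : x * (k%:R / (c * (c + 1))) <= k%:R / c.
  have -> : x * (k%:R / (c * (c + 1))) = (k%:R / c) * (x / (c + 1)).
    by field; rewrite !lt0r_neq0 //; lra.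
  apply: ler_piMr; first by rewrite divr_ge0 // ltW.
  rewrite ler_pdivrMr; last by rewrite /c; lra.
  by rewrite /c; lra.
have h3 : x * (B / (c * (c + B))) <= 1 / c.
  have -> : x * (B / (c * (c + B))) = (B / c) * (x / (c + B)).
    by field; rewrite !lt0r_neq0 //; lra.
  apply: (@le_trans _ _ (B / c)).
    apply: ler_piMr; first by rewrite divr_ge0 // ltW.
    rewrite ler_pdivrMr; last by rewrite /c; lra.
    by rewrite /c; lra.
  by rewrite ler_wpM2r ?invr_ge0 ?ltW.
have h4 : (r%:R * b%:R + k%:R + 1) / c <= 1.
  by rewrite ler_pdivrMr // mul1r /c; lra.
by rewrite 2!mulrBr h1; lra.
Qed.

Lemma turan_secular_root x : 200 * q%:R < x -> f x <= r%:R - 1 ->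
  exists2 z, x <= z & f z = r%:R - 1.
Proof.
move=> xq fx; have q1 : 1 <= q%:R :> R by rewrite ler1n.
pose w := x + (r%:R * b%:R + k%:R + 1).
have rbk : 0 <= r%:R * b%:R + k%:R + 1 :> R by rewrite !addr_ge0 ?mulr_ge0.
have xw : x <= w by rewrite /w lerDl.
have fw : r%:R - 1 <= f w by apply: turan_secular_large; rewrite /w; lra.
have cont : {within classical_sets.mkset (fun z => z \in `[x, w]), continuous f}.
  apply: continuous_in_subspaceT => z /classical_sets.set_mem; rewrite /= in_itv /= => /andP[xz _].
  by apply: turan_secular_continuous; apply: lt_le_trans xz.
have [|z] := IVT xw cont (v := r%:R - 1).
  by rewrite ge_min fx le_max fw orbT.
by rewrite in_itv /= => /andP[xz _] fz; exists z.
Qed.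

End TuranEigenvalue.

(** * Reconstruction of the extremal graph *)

(** The m-th element of each colour class goes to the m-th element of the class of the same colour.
    The default [x0] of [nth] is never reached. *)
Lemma colour_bij (T T' : finType) (C : finType) (f : T -> C) (f' : T' -> C) (x0 : T') :
  (forall c, #|[set v | f v == c]| = #|[set v | f' v == c]|) ->
  exists2 g : T -> T', bijective g & forall v, f' (g v) = f v.
Proof.
move=> eqc; pose cl c := enum [set v | f v == c]; pose cl' c := enum [set v | f' v == c].
pose g v := nth x0 (cl' (f v)) (index v (cl (f v))).
have idx v : (index v (cl (f v)) < size (cl' (f v)))%N.
  by rewrite -cardE -eqc cardE index_mem mem_enum inE.
have gE v : f' (g v) = f v.
  by have := mem_nth x0 (idx v); rewrite mem_enum inE => /eqP.
exists g => //; apply: inj_card_bij.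
  move=> u v guv; have fuv : f u = f v by rewrite -!gE guv.
  move/eqP: guv; rewrite /g fuv nth_uniq ?enum_uniq //; last by rewrite -fuv idx.
  move=> /eqP iuv; rewrite -(nth_index u (s := cl (f v)) (x := u)) ?mem_enum ?inE ?fuv //.
  by rewrite iuv nth_index // mem_enum inE.
have card (S : finType) (h : S -> C) : #|S| = (\sum_c #|[set v | h v == c]|)%N.
  rewrite -sum1_card (partition_big h predT) //=.
  by apply: eq_bigr => c _; rewrite -sum1dep_card.
by rewrite (card T f) (card T' f'); apply: leq_sum => c _; rewrite eqc.
Qed.

(** The total exceeds |I| b by k, so exactly k indices have value b + 1. Hence the class sizes do
    not depend on [s], as needed to match two families of parts by [colour_bij]. *)
Lemma card_two_values (I : finType) (s : I -> nat) (b k : nat) (j : I) :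
  (\sum_i s i = #|I| * b + k)%N -> s j = b -> (forall i, s i = b \/ s i = b.+1) ->
  forall (m t : bool), #|[set i | (s i == b.+1, i == j) == (m, t)]| =
  (if m then if t then 0 else k else if t then 1 else #|I| - k - 1)%N.
Proof.
move=> ss sj sv.
have sk : #|[set i | s i == b.+1]| = k.
  have -> : #|[set i | s i == b.+1]| = (\sum_i (s i - b))%N.
    rewrite -sum1dep_card big_mkcond; apply: eq_bigr => i _.
    by case: (sv i) => ->; case: eqP; lia.
  apply/eqP; rewrite -(eqn_add2l (#|I| * b)) -ss -sum_nat_const -big_split /=.
  by apply/eqP/eq_bigr => i _; case: (sv i) => ->; lia.
have jk : j \notin [set i | s i == b.+1] by rewrite inE sj; lia.
case=> -[].
- apply: eq_card0 => i; rewrite !inE xpair_eqE !eqb_id.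
  by apply/andP => -[/eqP si /eqP ij]; rewrite ij sj in si; lia.
- rewrite -[RHS]sk; apply: eq_card => i; rewrite !inE xpair_eqE eqb_id eqbF_neg.
  by have [->|] := eqVneq i j; rewrite ?andbT // sj; lia.
- rewrite -(cards1 j); apply: eq_card => i; rewrite !inE xpair_eqE eqb_id eqbF_neg.
  by have [->|] := eqVneq i j; rewrite ?andbF // sj; lia.
have cU : #|j |: [set i | s i == b.+1]| = k.+1 by rewrite cardsU1 jk sk.
have := cardsC (j |: [set i | s i == b.+1]); rewrite cU.
have -> : #|~: (j |: [set i | s i == b.+1])| =
    #|[set i | (s i == b.+1, i == j) == (false, false)]|.
  apply: eq_card => i; rewrite !inE xpair_eqE negb_or.
  by case: (s i == _); case: (i == j).
lia.
Qed.

Section Roles.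
Variables (T : finType) (H : rel T).
Hypotheses (Hsym : symmetric H) (Hirr : irreflexive H).
Variable q : nat.
Hypotheses (q_gt0 : (0 < q)%N) (sum_deg : (\sum_v deg H v = q.*2)%N).
Variables (r : nat) (p : T -> 'I_r) (j : 'I_r).
Hypothesis Hj : forall u v, H u v -> p u = j.

(* [Some true] marks the centre of a star, [Some false] its leaves or the
   vertices of a triangle. *)
Definition role_adj (a b : option bool) : bool :=
  if q == 3%N then (a == Some false) && (b == Some false)
  else (a == Some true) && (b == Some false) || (a == Some false) && (b == Some true).

(** The number of vertices of role [a] in a part of size [m]; [inj] says whether that part carries
    the class-edges. *)
Definition role_card (inj : bool) (m : nat) (a : option bool) : nat :=
  match a with
  | Some true => (q != 3%N) && inj
  | Some false => q * inj
  | None => m - ((q != 3%N) && inj) - q * inj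
  end.

(** Reduces the isomorphism to matching colours: roles determine the class-edges, and how often each
    role occurs in a part depends only on the size of the part and on whether it is [j]. *)
Lemma best_roles : best_class_edges H q ->
  exists2 rho : T -> option bool,
    forall u v, H u v = (u != v) && role_adj (rho u) (rho v) &
    forall i a, #|[set v | (p v == i) && (rho v == a)]| = role_card (i == j) (psize p i) a.
Proof.
move=> best.
suff [rho rhoH [rt rf]] : exists2 rho : T -> option bool,
    forall u v, H u v = (u != v) && role_adj (rho u) (rho v) &
    (forall i, #|[set v | (p v == i) && (rho v == Some true)]| = ((q != 3%N) && (i == j) : nat)) /\
    (forall i, #|[set v | (p v == i) && (rho v == Some false)]| = q * (i == j))%N.
  exists rho => // i [[]|] //=; rewrite -rt -rf.
  have -> : psize p i = (#|[set v | (p v == i) && (rho v == Some true)]| +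
     (#|[set v | (p v == i) && (rho v == Some false)]| +
      #|[set v | (p v == i) && (rho v == None)]|))%N.
    rewrite /psize -!sum1dep_card (bigID (fun v => rho v == Some true)) /=; congr (_ + _)%N.
    rewrite (bigID (fun v => rho v == Some false)) /=; congr (_ + _)%N.
      by apply: eq_bigl => v; case: (rho v) => [[]|]; rewrite ?andbF ?andbT.
    by apply: eq_bigl => v; case: (rho v) => [[]|]; rewrite ?andbF ?andbT.
  by rewrite !addKn.
move: best; rewrite /best_class_edges /role_adj; case: eqP => [q3|_] /=.
  case=> A [A3 HA].
  have pA v : v \in A -> p v = j.
    move=> vA; have /card_gt0P[u] : (0 < #|A :\ v|)%N.
      by have := cardsD1 v A; rewrite vA A3; lia.
    by rewrite !inE => /andP[uv uA]; apply: (Hj (v := u)); rewrite HA eq_sym uv vA.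
  exists (fun v => if v \in A then Some false else None).
    by move=> u v; rewrite HA; case: (u \in A); case: (v \in A); rewrite ?andbF.
  split=> i.
    by apply: eq_card0 => v; rewrite !inE; case: (v \in A); rewrite andbF.
  have [->|ij] := eqVneq i j.
    rewrite muln1 q3 -A3; apply: eq_card => v; rewrite !inE.
    by case: ifP => vA; rewrite ?andbF // pA // eqxx.
  rewrite muln0; apply: eq_card0 => v; rewrite !inE; case: ifP => vA; rewrite ?andbF //.
  by rewrite pA // eq_sym (negPf ij).
case=> c st.
have dc : deg H c = q by have := star_sum_deg Hsym Hirr st; rewrite sum_deg; lia.
have [l Hcl] : exists l, H c l.
  by have /card_gt0P[l] : (0 < deg H c)%N by [rewrite dc]; rewrite inE; exists l.
have pc : p c = j := Hj Hcl.
have cn v : H c v -> (v == c) = false by apply: contraTF => /eqP ->; rewrite Hirr.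
exists (fun v => if v == c then Some true else if H c v then Some false else None).
  move=> u v; have [->|uc] := eqVneq u c; have [->|vc] := eqVneq v c; rewrite ?eqxx ?Hirr //=.
  - by case: (H c v).
  - by rewrite uc [H u c]Hsym; case: (H c u).
  rewrite [RHS](_ : _ = false).
    by apply/negP => /st; rewrite (negPf uc) (negPf vc).
  by do 2![case: ifP => _]; rewrite ?andbF.
split=> i.
  have [->|ij] := eqVneq i j.
    transitivity #|[set c]|; last by rewrite cards1.
    apply: eq_card => v; rewrite !inE.
    by have [->|vc] := eqVneq v c; [rewrite pc !eqxx | case: (H c v); rewrite andbF].
  apply: eq_card0 => v; rewrite !inE; have [->|vc] := eqVneq v c.
    by rewrite pc eq_sym (negPf ij).
  by case: (H c v); rewrite andbF.
have [->|ij] := eqVneq i j.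
  rewrite muln1 -dc; apply: eq_card => v; rewrite !inE.
  have [->|vc] := eqVneq v c; first by rewrite andbF Hirr.
  case: ifP => Hcv; rewrite ?andbF //.
  by rewrite (Hj (v := c)) ?eqxx // Hsym.
rewrite muln0; apply: eq_card0 => v; rewrite !inE.
have [->|vc] := eqVneq v c; first by rewrite andbF.
case: ifP => Hcv; rewrite ?andbF //.
by rewrite (Hj (u := v) (v := c)) 1?Hsym // eq_sym (negPf ij).
Qed.

End Roles.

(** * Eigenvectors as vertex weights, edge sets as relations *)

Lemma eigenvalue_adjmxP (R : realType) (G : sgraph) (lam : R) :
  eigenvalue (adjmx R G) lam <->
  exists2 x : G -> R, (exists v, x v != 0) &
    forall v, lam * x v = \sum_(u | adj v u) x u.
Proof.
have mulE (w : 'rV_#|G|) v :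
    (w *m adjmx R G) 0 (enum_rank v) = \sum_(u | adj v u) w 0 (enum_rank u).
  rewrite (mulmx_enum (fun u v : G => (adj u v)%:R)) [RHS]big_mkcond.
  by apply: eq_bigr => u _; rewrite adj_sym; case: adj; rewrite ?mulr1 ?mulr0.
split=> [/eigenvalueP[w wA w0]|[x [v xv] ex]].
  exists (fun v => w 0 (enum_rank v)) => [|v]; last by rewrite -mulE wA mxE.
  apply/existsP; apply: contraNT w0 => /existsPn w0; apply/eqP/rowP => i.
  by rewrite mxE -[i]enum_valK; apply/eqP; move/(_ (enum_val i)): w0; rewrite negbK.
apply/eigenvalueP; exists (\row_i x (enum_val i)).
  apply/rowP => i; rewrite -[i]enum_valK mulE !mxE enum_rankK ex.
  by apply: eq_bigr => u _; rewrite mxE enum_rankK.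
apply: contraNneq xv => /rowP/(_ (enum_rank v)).
by rewrite !mxE enum_rankK => ->.
Qed.

Lemma eigenvalue_iso (R : realType) (G K : sgraph) (lam : R) :
  graph_iso G K -> eigenvalue (adjmx R G) lam -> eigenvalue (adjmx R K) lam.
Proof.
case=> f [g fK gK] fadj /eigenvalue_adjmxP[x [v xv] ex]; apply/eigenvalue_adjmxP.
exists (x \o g) => [|u /=]; first by exists (f v); rewrite /= fK.
rewrite ex (reindex g) /=; last by exists f => ? _; rewrite ?fK ?gK.
by apply: eq_bigl => w; rewrite -fadj !gK.
Qed.

Definition edge_rel (T : finType) (F : {set {set T}}) : rel T :=
  fun v u => (v != u) && ([set v; u] \in F).

Lemma edge_rel_sym (T : finType) (F : {set {set T}}) : symmetric (edge_rel F).
Proof. by move=> u v; rewrite /edge_rel eq_sym finset.setUC. Qed.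

Lemma edge_rel_irr (T : finType) (F : {set {set T}}) : irreflexive (edge_rel F).
Proof. by move=> u; rewrite /edge_rel eqxx. Qed.

Lemma handshake (T : finType) (F : {set {set T}}) :
  (forall e, e \in F -> #|e| = 2%N) ->
  (\sum_v deg (edge_rel F) v = #|F|.*2)%N.
Proof.
move=> F2; have degE v : deg (edge_rel F) v = (\sum_(e in F) (v \in e))%N.
  rewrite /deg -(card_in_imset (f := fun u => [set v; u])); last first.
    move=> a b; rewrite !inE => /andP[va _] /andP[vb _] /setP/(_ a).
    by rewrite !inE eqxx orbT eq_sym (negPf va) => /esym/eqP.
  rewrite -[RHS]big_mkcondr /= sum1dep_card; apply: eq_card => e; rewrite inE.
  apply/imsetP/andP => [[u]|[eF ve]].
    by rewrite inE => /andP[_ uF] ->; rewrite uF !inE eqxx.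
  have /eqP/cards2P[a [b [ab eE]]] := F2 _ eF.
  move: ve; rewrite eE !inE => /orP[] /eqP va; subst v.
    by exists b => //; rewrite inE /edge_rel ab -eE.
  by exists a; rewrite 1?finset.setUC // inE /edge_rel eq_sym ab finset.setUC -eE.
under eq_bigr do rewrite degE.
rewrite exchange_big /= -muln2 -sum_nat_const; apply: eq_bigr => e eF.
by rewrite -(F2 _ eF) -sum1_card [RHS]big_mkcond; apply: eq_bigr => v _; case: (v \in e).
Qed.

Section Multipartite.
Variables (r : nat) (s : 'I_r -> nat).

Lemma card_part (P : pred nat) i :
  #|[set v : Kvertex s | (part v == i) && P (pos v)]| = (\sum_(m < s i) P m)%N.
Proof.
have -> : [set v : Kvertex s | (part v == i) && P (pos v)]
    = [set Tagged (fun i => 'I_(s i)) m | m : 'I_(s i) & P m].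
  apply/setP => -[i' m]; rewrite !inE /part /pos /=; apply/andP/imsetP.
    by case=> /eqP e Pm; subst i'; exists m => //; rewrite inE.
  case=> m'; rewrite inE => Pm' e; have := congr1 tag e => /= e'; subst i'.
  by rewrite eqxx; move/eqP: e; rewrite eq_Tagged /= => /eqP ->.
rewrite card_imset; last by move=> a b /eqP; rewrite eq_Tagged => /eqP.
by rewrite -sum1dep_card big_mkcond; apply: eq_bigr => m _; case: (P m).
Qed.

Lemma psize_part i : psize (@part r s) i = s i.
Proof.
have := card_part predT i; rewrite sum_nat_const card_ord muln1 => <-.
by apply: eq_card => v; rewrite !inE andbT.
Qed.

Lemma Kvertex_eq (u v : Kvertex s) : part u = part v -> pos u = pos v -> u = v.
Proof.
case: u v => i a [i' b]; rewrite /part /pos /= => e; subst i' => ab.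
by congr existT; exact: val_inj.
Qed.

Variable F : {set {set complete_multipartite s}}.
Hypothesis FK : F \subset class_edges s.

Lemma class_edge_card e : e \in F -> #|e| = 2%N.
Proof.
move=> /(subsetP FK) /imsetP[[u v]]; rewrite inE /= => /andP[uv _] ->.
by rewrite cards2 uv.
Qed.

Lemma class_edge_part u v : edge_rel F u v -> part u = part v.
Proof.
move=> /andP[uv /(subsetP FK) /imsetP[[a b]]]; rewrite inE /= => /andP[ab /eqP pab] e.
have : u \in [set a; b] by rewrite -e !inE eqxx.
have : v \in [set a; b] by rewrite -e !inE eqxx orbT.
by rewrite !inE => /orP[] /eqP -> /orP[] /eqP ->.
Qed.

(** Puts the eigenvalue equation in the form of [secular_eq]; the two sums do not overlap because
    class-edges stay inside parts. *)
Lemma sum_add_edges (R : realType) (x : Kvertex s -> R) v :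
  \sum_(u | @adj (add_edges F) v u) x u =
  \sum_(u | part v != part u) x u + \sum_(u | edge_rel F v u) x u.
Proof.
rewrite (bigID (fun u => part v != part u)) /=; congr (_ + _); apply: eq_bigl => u.
  by rewrite /= /add_edges_adj /= /Kadj; case: (part v != part u); rewrite ?andbF.
rewrite /= /add_edges_adj /= /Kadj -/(edge_rel F v u).
have [e|ne] /= := eqVneq (part v) (part u); first by rewrite andbT.
by apply/esym/negP => /class_edge_part; apply/eqP.
Qed.

End Multipartite.

Lemma graph_iso_trans (G H K : sgraph) :
  graph_iso G H -> graph_iso H K -> graph_iso G K.
Proof.
case=> f fb fa [g gb ga]; exists (g \o f); first exact: bij_comp.
by move=> x y /=; rewrite ga fa.
Qed.

Section ExtremalIso.
Variables (r b k q : nat) (s s' : 'I_r -> nat).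
Variables (F : {set {set complete_multipartite s}}).
Variables (F' : {set {set complete_multipartite s'}}).
Hypotheses (FK : F \subset class_edges s) (FK' : F' \subset class_edges s').
Hypotheses (q_gt0 : (0 < q)%N).
Variables (j j' : 'I_r).

Lemma extremal_iso :
  #|F| = q -> #|F'| = q ->
  (\sum_i s i = r * b + k)%N -> (\sum_i s' i = r * b + k)%N ->
  s j = b -> s' j' = b ->
  (forall i, s i = b \/ s i = b.+1) -> (forall i, s' i = b \/ s' i = b.+1) ->
  (forall u v, edge_rel F u v -> part u = j) ->
  (forall u v, edge_rel F' u v -> part u = j') ->
  best_class_edges (edge_rel F) q -> best_class_edges (edge_rel F') q ->
  graph_iso (add_edges F) (add_edges F').
Proof.
move=> cF cF' ss ss' sj sj' sv sv' Fj Fj' best best'.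
have sd := handshake (class_edge_card FK); rewrite cF in sd.
have sd' := handshake (class_edge_card FK'); rewrite cF' in sd'.
have [rho rhoE rhoC] := best_roles (@edge_rel_sym _ F) (@edge_rel_irr _ F) q_gt0 sd Fj best.
have [rho' rhoE' rhoC'] := best_roles (@edge_rel_sym _ F') (@edge_rel_irr _ F') q_gt0 sd' Fj' best'.
(* First the parts are matched, by size and by whether they carry the class-edges. *)
have [|sg sgb sgE] := @colour_bij _ _ _ (fun i => (s i == b.+1, i == j))
   (fun i => (s' i == b.+1, i == j')) j'.
  by case=> m t; rewrite !(card_two_values (k := k) _ _ _) ?card_ord.
have sgj i : (sg i == j') = (i == j) by case: (sgE i).
have sgs i : s' (sg i) = s i.
  by case: (sgE i) => + _; case: (sv i) => ->; case: (sv' (sg i)) => -> //; lia.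
have [sg' sgK sgK'] := sgb.
have [x0 _] : exists x0 : Kvertex s', True.
  have /card_gt0P[e eF'] : (0 < #|F'|)%N by rewrite cF'.
  have /card_gt0P[x _] : (0 < #|e|)%N by rewrite (class_edge_card FK').
  by exists x.
(* Then the vertices are matched, coloured by target part and role; adjacency of distinct vertices
   depends on these only. *)
have [|f fb fE] := @colour_bij (Kvertex s) (Kvertex s') _ (fun v => (sg (part v), rho v))
    (fun v => (part v, rho' v)) x0.
  case=> i a; transitivity #|[set v : Kvertex s | (part v == sg' i) && (rho v == a)]|.
    by apply: eq_card => v; rewrite !inE xpair_eqE -[in RHS](bij_eq sgb) sgK'.
  rewrite rhoC !psize_part -sgj sgK' -[s _]sgs sgK' -(psize_part s' i) -rhoC'.
  by apply: eq_card => v; rewrite !inE.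
exists f => // u v; rewrite /= /add_edges_adj /= /Kadj.
rewrite -!/(edge_rel _ _ _) rhoE rhoE' (bij_eq fb).
have [pu ru] : part (f u) = sg (part u) /\ rho' (f u) = rho u by have [] := fE u.
have [pv rv] : part (f v) = sg (part v) /\ rho' (f v) = rho v by have [] := fE v.
by rewrite pu pv ru rv (bij_eq sgb).
Qed.

End ExtremalIso.

(** * Class-edges and eigenvalues of L *)

Lemma Hadj_sym q : symmetric (Hadj q).
Proof.
move=> i j; rewrite /Hadj; case: ifP => _; first by rewrite eq_sym; congr (_ && _); exact: andbC.
by rewrite orbC.
Qed.

Lemma Hadj_irr q : irreflexive (Hadj q).
Proof. by move=> i; rewrite /Hadj eqxx; case: ifP => //; lia. Qed.

Lemma sum_ltn (N k : nat) : (\sum_(m < N) (m < k) = minn N k)%N.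
Proof. by elim: N => [|N IHN]; rewrite ?big_ord0 ?big_ord_recr /= ?IHN; lia. Qed.

Lemma sum_between (N q : nat) : (\sum_(m < N) (0 < m <= q) = minn N.-1 q)%N.
Proof. by elim: N => [|N IHN]; rewrite ?big_ord0 ?big_ord_recr /= ?IHN; lia. Qed.

Section Lgraph.
Variables (n r : nat).

Let b := (n %/ r.+1)%N.
Let k := (n %% r.+1)%N.
Lemma turan_size_cases i : turan_size n r.+1 i = b \/ turan_size n r.+1 i = b.+1.
Proof. by rewrite /turan_size -/b; case: ltnP; lia. Qed.

Lemma turan_size_max : turan_size n r.+1 ord_max = b.
Proof. by rewrite /turan_size /=; have := ltn_pmod n (ltn0Sn r); rewrite /b; lia. Qed.

Lemma sum_turan_size : (\sum_i turan_size n r.+1 i = r.+1 * b + k)%N.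
Proof.
rewrite /turan_size big_split /= sum_nat_const card_ord sum_ltn; congr (_ + _)%N.
by apply/minn_idPr/ltnW/ltn_pmod.
Qed.

Variable q : nat.
Let HL := edge_rel (L_edges n r.+1 q).

Lemma L_edge_relE u v :
  HL u v = [&& part u == ord_max, part v == ord_max & Hadj q (pos u) (pos v)].
Proof.
have omE (w : Kvertex (turan_size n r.+1)) : (part w == r.+1.-1 :> nat) = (part w == ord_max) by [].
apply/andP/and3P => [[uv /imsetP[[x y]]]|[pu pv Huv]].
  rewrite inE /= !omE => /and3P[px py Hxy] e.
  have : u \in [set x; y] by rewrite -e !inE eqxx.
  have : v \in [set x; y] by rewrite -e !inE eqxx orbT.
  rewrite !inE => /orP[] /eqP ? /orP[] /eqP ?; subst u v; rewrite ?eqxx // in uv *.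
  by rewrite Hadj_sym.
split; first by apply: contraTneq Huv => ->; rewrite Hadj_irr.
by apply/imsetP; exists (u, v) => //; rewrite inE /= !omE pu pv.
Qed.

Lemma L_edges_sub : L_edges n r.+1 q \subset class_edges (turan_size n r.+1).
Proof.
apply/subsetP => e /imsetP[[u v]]; rewrite inE /= => /and3P[pu pv Huv] ->.
apply/imsetP; exists (u, v) => //; rewrite inE /=; apply/andP; split.
  by apply: contraTneq Huv => ->; rewrite Hadj_irr.
by apply/eqP/val_inj; rewrite /= (eqP pu) (eqP pv).
Qed.

Lemma L_part u v : HL u v -> part u = ord_max.
Proof. by rewrite L_edge_relE => /and3P[/eqP]. Qed.

Hypotheses (q_gt0 : (0 < q)%N) (q_small : (q < n %/ r.+1)%N).

Let A := [set v : Kvertex (turan_size n r.+1) | (part v == ord_max) && (pos v < 3)%N].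
Let turan_size_max_gt0 : (0 < turan_size n r.+1 ord_max)%N.
Proof. by rewrite turan_size_max /b; lia. Qed.

Let center : Kvertex (turan_size n r.+1) :=
  Tagged (fun i => 'I_(turan_size n r.+1 i)) (Ordinal turan_size_max_gt0).

Lemma L_triangle : q = 3%N -> is_triangle HL A.
Proof.
move=> q3; split; first by rewrite /A (card_part _ (fun m => (m < 3)%N)) sum_ltn turan_size_max /b; lia.
move=> u v; rewrite L_edge_relE /Hadj q3 eqxx !inE.
case: (eqVneq (part u)) => pu //=; last by rewrite andbF.
case: (eqVneq (part v)) => pv //=; last by rewrite !andbF.
congr (~~ _ && _); apply/eqP/eqP => [|->//].
by apply: Kvertex_eq; rewrite pu pv.
Qed.

Lemma L_star : q != 3%N -> is_star HL center.
Proof.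
move=> q3 u v; rewrite L_edge_relE /Hadj (negPf q3) => /and3P[/eqP pu /eqP pv].
case/orP => /andP[/eqP p0 _]; apply/orP; [left|right]; apply/eqP/Kvertex_eq;
  by rewrite ?pu ?pv ?p0.
Qed.

Lemma L_best : best_class_edges HL q.
Proof.
rewrite /best_class_edges; case: eqP => [/L_triangle tr|/eqP/L_star st].
  by exists A.
by exists center.
Qed.

Lemma L_sum_deg : (\sum_v deg HL v = q.*2)%N.
Proof.
have Hs := @edge_rel_sym _ (L_edges n r.+1 q).
have Hi := @edge_rel_irr _ (L_edges n r.+1 q).
have [q3|q3] := eqVneq q 3%N.
  by rewrite (triangle_sum_deg (L_triangle q3)) q3.
rewrite (star_sum_deg Hs Hi (L_star q3)); congr _.*2.
transitivity #|[set v : Kvertex (turan_size n r.+1) | (part v == ord_max) && (0 < pos v <= q)%N]|.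
  apply: eq_card => v; rewrite !inE -/(HL _ _) L_edge_relE eqxx /Hadj (negPf q3) /=.
  by rewrite andbF orbF.
(* As q < b, the last part contains all the positions 1, ..., q besides the centre 0. *)
by rewrite (card_part _ (fun m => (0 < m <= q)%N)) sum_between turan_size_max /b; lia.
Qed.

(** The set is an image under a map that forgets the order of the ends, so it is counted through
    degrees. *)
Lemma card_L_edges : #|L_edges n r.+1 q| = q.
Proof.
by have := handshake (class_edge_card L_edges_sub); rewrite L_sum_deg => /double_inj.
Qed.

Lemma L_multipartite_plus : multipartite_plus n r.+1 q (Lgraph n r.+1 q).
Proof.
exists (turan_size n r.+1); split.
- move=> i j ij; rewrite /turan_size leq_add2l.
  by case: ltnP => // /(leq_ltn_trans ij) ->.
- by rewrite sum_turan_size mulnC -divn_eq.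
exists (L_edges n r.+1 q); split; [exact: L_edges_sub|exact: card_L_edges|].
by exists id => //; exists id.
Qed.

(** The intermediate value theorem gives z, and [best_secular] shows that the secular equation of L
    holds there. *)
Lemma L_eigenvalue (R : realType) (x : R) : 200 * q%:R < x ->
  x * turan_secular r.+1 b k x (best_excess q x) <= r.+1%:R - 1 ->
  exists z, [/\ x <= z, eigenvalue (adjmx R (Lgraph n r.+1 q)) z &
     z * turan_secular r.+1 b k z (best_excess q z) = r.+1%:R - 1].
Proof.
move=> xq /(turan_secular_root q_gt0 xq)[z xz fz]; exists z; split => //.
have zq : 200 * q%:R < z by apply: lt_le_trans xz.
have z0 : 0 < z by have := ler0n R q; lra.
have Hs := @edge_rel_sym _ (L_edges n r.+1 q).
have Hi := @edge_rel_irr _ (L_edges n r.+1 q).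
have Hp := class_edge_part L_edges_sub.
have [y ey] := resolvent_ex Hs Hi L_sum_deg zq.
have ss : (\sum_i psize (@part _ (turan_size n r.+1)) i = r.+1 * b + k)%N.
  by under eq_bigr do rewrite psize_part; exact: sum_turan_size.
have sec := best_secular Hs Hi q_gt0 L_sum_deg zq ey ss L_best L_part.
have pos_i i : 0 < z + (psize (@part _ (turan_size n r.+1)) i)%:R + pexcess HL (@part _ _) y i.
  by rewrite !ltr_wpDr // (pexcess_ge0 Hs Hi L_sum_deg _ zq).
have [|x' x0 ex'] := secular_eigen Hs Hi L_sum_deg zq Hp ey pos_i.
  rewrite sec ?psize_part ?turan_size_max // => [|i]; last by rewrite psize_part; exact: turan_size_cases.
  by rewrite -fz mulrAC mulfV ?mul1r // lt0r_neq0.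
apply/eigenvalue_adjmxP; exists x'; first by exists center.
by move=> v; rewrite ex' sum_add_edges //; exact: L_edges_sub.
Qed.

End Lgraph.

(* Gives L, hence G, a spectral radius of at least [n / 4], far above [q]. *)
Lemma turan_secular_quarter (R : realType) (n r q : nat) : (0 < r)%N ->
  (0 < q)%N -> (q < n %/ r.+1)%N -> 200 * q%:R < n%:R / 4 :> R ->
  n%:R / 4 * turan_secular r.+1 (n %/ r.+1) (n %% r.+1) (n%:R / 4)
    (best_excess q (n%:R / 4)) <= r.+1%:R - 1 :> R.
Proof.
move=> r0 q0 qb xq; set b := (n %/ r.+1)%N; set k := (n %% r.+1)%N; set x : R := n%:R / 4.
have B0 := best_excess_gt0 q0 xq.
have x0 : 0 < x by have := ler0n R q; rewrite /x; lra.
have b0 := ler0n R b; have k0 := ler0n R k.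
have c0 : 0 < x + b%:R by lra.
apply: (@le_trans _ _ (x * (r.+1%:R / (x + b%:R)))).
  rewrite ler_pM2l // /turan_secular -addrA gerDl -opprD oppr_le0 addr_ge0 //.
    by rewrite divr_ge0 // mulr_ge0 //; lra.
  by rewrite /delta divr_ge0 ?mulr_ge0 //; lra.
rewrite mulrA ler_pdivrMr //.
(* As r >= 1 and b >= 1, n < (r + 1) (b + 1) <= 4 r b. *)
have xb : x <= r%:R * b%:R.
  rewrite /x ler_pdivrMr // -!natrM ler_nat.
  have := divn_eq n r.+1; have := ltn_pmod n (ltn0Sn r); rewrite -/b -/k.
  have : (1 <= b)%N by lia.
  nia.
rewrite -natr1; lra.
Qed.

Theorem theorem6p2 (R : realType) (r : nat) (hr : (2 <= r)%N) :
  exists n0 : nat, forall n : nat, (n0 <= n)%N ->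
  forall q : nat, (1 <= q)%N ->
  (q%:R : R) <= n%:R / (20 ^+ 3 * r%:R) ->
  forall G : sgraph,
  multipartite_plus n r q G ->
  (forall G' : sgraph, multipartite_plus n r q G' ->
     spectral_radius R G' <= spectral_radius R G) ->
  graph_iso G (Lgraph n r q).
Proof.
(* Largeness of [n] comes from 1 <= q <= n / (20^3 r), which gives n >= 20^3 r. From here on the
   number of parts is [r.+1]. *)
exists 0%N => n _ q q_gt0; case: r hr => [//|r r1].
have r0 : 0 < r.+1%:R :> R by rewrite ltr0n.
have t0 : 0 < 20 ^+ 3 * r.+1%:R :> R by rewrite mulr_gt0 // exprn_gt0.
rewrite ler_pdivlMr // => hq G [s [_ ss [F [FK cF isoG]]]] maxG.
have qn : (q * 1000 * r.+1 <= n)%N.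
  rewrite -(ler_nat R) !natrM.
  by have := mulr_ge0 (ler0n R q) (ler0n R r.+1); lra.
have qb : (q < n %/ r.+1)%N.
  by have : (q * 1000 <= n %/ r.+1)%N; [rewrite leq_divRL | lia].
have xq : 200 * q%:R < n%:R / 4 :> R.
  rewrite ltr_pdivlMr // -!natrM ltr_nat; nia.
have LM := L_multipartite_plus q_gt0 qb.
have n_gt0 : (0 < n)%N by lia.
have cardK (s' : 'I_r.+1 -> nat) : (\sum_i s' i = n)%N -> (0 < #|Kvertex s'|)%N.
  move=> sn; have : (0 < \sum_i s' i)%N by rewrite sn.
  rewrite lt0n sum_nat_eq0 => /forallPn[/= i]; rewrite -lt0n => si.
  by apply/card_gt0P; exists (Tagged (fun i => 'I_(s' i)) (Ordinal si)).
have G_gt0 : (0 < #|G|)%N.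
  by case: isoG => f fb _; rewrite (bij_eq_card fb); exact: cardK ss.
have L_gt0 : (0 < #|Lgraph n r.+1 q|)%N.
  apply: cardK; rewrite sum_turan_size mulnC -divn_eq //.
set lam := spectral_radius R G.
have [eigG _] := spectral_radius_max R G_gt0.
have L_le z : eigenvalue (adjmx R (Lgraph n r.+1 q)) z -> z <= lam.
  move=> ez; apply: le_trans (maxG _ LM).
  by have [_] := spectral_radius_max R L_gt0; apply.
(* By maximality lam is at least an eigenvalue of L that is at least n / 4; this opens the way to
   all estimates above. *)
have lam_q : 200 * q%:R < lam.
  have [z [xz ez _]] := L_eigenvalue q_gt0 qb xq (turan_secular_quarter r1 q_gt0 qb xq).
  by rewrite (lt_le_trans xq) // (le_trans xz) // L_le.
have lam0 : 0 < lam by have := ler0n R q; lra.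
have /eigenvalue_adjmxP[x x0 ex] := eigenvalue_iso isoG eigG.
have Hs := @edge_rel_sym _ F; have Hi := @edge_rel_irr _ F.
have sd := handshake (class_edge_card FK); rewrite cF in sd.
have Hp := class_edge_part FK.
have [|y ey sec] := secular_eq Hs Hi sd lam_q Hp x0.
  by move=> v; rewrite ex sum_add_edges.
have sb : (\sum_i s i = r.+1 * (n %/ r.+1) + n %% r.+1)%N.
  by rewrite ss mulnC -divn_eq.
have psb : (\sum_i psize (@part _ s) i = r.+1 * (n %/ r.+1) + n %% r.+1)%N.
  by under eq_bigr do rewrite psize_part.
case: (secular_compare Hs Hi q_gt0 sd Hp lam_q ey psb sec) => [lt_lam|[best [j [Fj sj sv]]]].
  rewrite ltr_pdivlMr // mulrC in lt_lam.
  (* L has an eigenvalue z >= lam solving its secular equation. Maximality gives z = lam, where the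
     inequality is strict. *)
  have [z [xz ez fz]] := L_eigenvalue q_gt0 qb lam_q (ltW lt_lam).
  have zl : z = lam by apply/eqP; rewrite eq_le xz L_le.
  by move: lt_lam; rewrite -zl fz ltxx.
apply: graph_iso_trans isoG _; rewrite psize_part in sj.
have sv' i : s i = (n %/ r.+1)%N \/ s i = (n %/ r.+1).+1 by rewrite -(psize_part s i).
have cL := card_L_edges q_gt0 qb.
exact: (extremal_iso FK (L_edges_sub n r q) q_gt0 cF cL sb (sum_turan_size n r)
  sj (turan_size_max n r) sv' (@turan_size_cases n r) Fj (@L_part n r q)
  best (L_best q_gt0 qb)).
Qed.
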